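(* Let $B=(B^{(1)},B^{(2)})$ be a two-dimensional Brownian motion in the filtration $(\mathcal F_t)_{t\ge 0}$ of a filtered probability space $(\Omega,(\mathcal F_t)_{t\ge0},\mathbf P)$, and let $\lambda\in\mathbb R$ be a constant with $\lambda\neq 0$. Then the solution of the equation $$dX_t=\operatorname{sign}(X_t)\,dB^{(1)}_t+\lambda\, dB^{(2)}_t$$ is pathwise unique.
   Context: The function $\operatorname{sign}$ takes the value $-1$ at zero: $\operatorname{sign}(x)=\mathbf 1_{\{x>0\}}-\mathbf 1_{\{x\le 0\}}$. A solution is a continuous $(\mathcal F_t)$-adapted process $X$ satisfying the equation in integrated (Itô) form. Pathwise uniqueness means: if $X,X'$ are two solutions on the same filtered probability space, driven by the same processes, with $X_0=X_0'$ almost surely, then almost surely $X_t=X'_t$ for all $t\ge 0$. *)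

(* Defs.v *)
From HB Require Import structures.
From mathcomp Require Import all_boot all_order all_algebra.
From mathcomp Require Import all_classical all_reals all_analysis.

Set Implicit Arguments.
Unset Strict Implicit.
Unset Printing Implicit Defensive.

Import Order.TTheory GRing.Theory Num.Theory.
Import numFieldNormedType.Exports.

Local Open Scope classical_set_scope.
Local Open Scope ring_scope.

(* Processes are functions R -> Omega -> T; only times t >= 0 are meaningful,
   and every condition below is restricted to such times. *)

(* The usual conditions (completeness, right-continuity) are not required. *)
Definition is_filtration (R : realType) (d : measure_display)
    (Omega : measurableType d) (F : R -> set (set Omega)) : Prop :=
  (forall t : R, 0 <= t -> sigma_algebra setT (F t)) /\
  (forall t : R, 0 <= t -> F t `<=` measurable) /\
  (forall s t : R, 0 <= s -> s <= t -> F s `<=` F t).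

Definition adapted (R : realType) (d d' : measure_display)
    (Omega : measurableType d) (T : measurableType d')
    (F : R -> set (set Omega)) (X : R -> Omega -> T) : Prop :=
  forall t : R, 0 <= t -> forall A : set T, measurable A -> F t (X t @^-1` A).

Definition continuous_paths (R : realType) (Omega : Type) (T : topologicalType)
    (X : R -> Omega -> T) : Prop :=
  forall w, {within [set t : R | 0 <= t], continuous (fun t => X t w)}.

(* The generating family is that of the product sigma-algebra
   Borel(R) (x) F t. *)
Definition progressively_measurable (R : realType) (d : measure_display)
    (Omega : measurableType d) (F : R -> set (set Omega))
    (H : R -> Omega -> R) : Prop :=
  forall t : R, 0 <= t -> forall D : set R, measurable D ->
    <<s [set C : set (R * Omega) | exists A : set R, exists E : set Omega,
           measurable A /\ F t E /\ C = A `*` E] >>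
      [set p | 0 <= p.1 <= t /\ D (H p.1 p.2)].

(* normal_prob takes the standard deviation as its second argument, so the law
   of the increment over [s, t] is N(0, (t - s) I_2). *)
Definition brownian_motion2 (R : realType) (d : measure_display)
    (Omega : measurableType d) (P : probability Omega R)
    (F : R -> set (set Omega)) (B : R -> Omega -> R * R) : Prop :=
  adapted F B /\ continuous_paths B /\
  {ae P, forall w, B 0 w = 0} /\
  (forall s t : R, 0 <= s -> s < t ->
     (forall (E : set Omega) (A : set (R * R)), F s E -> measurable A ->
        P (E `&` [set w | A (B t w - B s w)%R]) =
          (P E * P [set w | A (B t w - B s w)%R])%E) /\
     (forall A : set (R * R), measurable A ->
        P [set w | A (B t w - B s w)%R] =
          (normal_prob (0 : R) (Num.sqrt (t - s)) \x
             normal_prob (0 : R) (Num.sqrt (t - s)))%E A)).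

(* Data of the step process
     \sum_(i < n) xi_i 1_{]tau_i, tau_(i+1)]}. *)
Record step_process (R : realType) (Omega : Type) := StepProcess {
  step_size : nat ;
  step_time : nat -> R ;
  step_coef : nat -> Omega -> R }.

Definition simple_process (R : realType) (d : measure_display)
    (Omega : measurableType d) (F : R -> set (set Omega))
    (S : step_process R Omega) : Prop :=
  (forall i, 0 <= step_time S i <= step_time S i.+1) /\
  (forall i (A : set R), measurable A ->
     F (step_time S i) (step_coef S i @^-1` A)) /\
  (exists M : R, forall i w, `|step_coef S i w| <= M).

Definition step_value (R : realType) (Omega : Type) (S : step_process R Omega)
    (s : R) (w : Omega) : R :=
  \sum_(i < step_size S)
     step_coef S i w * (step_time S i < s <= step_time S i.+1)%R%:R.

Definition step_integral (R : realType) (Omega : Type)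
    (W : R -> Omega -> R) (S : step_process R Omega) (t : R) (w : Omega) : R :=
  \sum_(i < step_size S) step_coef S i w *
     (W (Num.min t (step_time S i.+1)) w - W (Num.min t (step_time S i)) w).

(* I is (a continuous version of) the Ito integral
     I_t = \int_0^t H_s dW_s
   of H in L^2(ds (x) P) on each [0, t] x Omega, W a Brownian motion in F: the
   L^2-limit of the integrals of simple processes converging to H in L^2.
   Square integrability of H follows from the approximation. Without the usual
   conditions I need not be F-adapted, so only measurability is asked. *)
Definition is_ito_integral (R : realType) (d : measure_display)
    (Omega : measurableType d) (P : probability Omega R)
    (F : R -> set (set Omega)) (W H I : R -> Omega -> R) : Prop :=
  progressively_measurable F H /\
  continuous_paths I /\
  (forall t : R, 0 <= t -> measurable_fun setT (I t)) /\
  (exists S : nat -> step_process R Omega,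
     (forall n, simple_process F (S n)) /\
     (forall t : R, 0 <= t ->
        (fun n => \int[P]_w \int[lebesgue_measure]_(s in `[0%R, t])
                    ((step_value (S n) s w - H s w) ^+ 2)%:E)%E
          @ \oo --> 0%E) /\
     (forall t : R, 0 <= t ->
        (fun n => \int[P]_w
                    ((step_integral W (S n) t w - I t w) ^+ 2)%:E)%E
          @ \oo --> 0%E)).

(* Value -1 at zero, unlike Num.sg. *)
Definition sign (R : realType) (x : R) : R := (0 < x)%R%:R - (x <= 0)%R%:R.

(* X_t = X_0 + \int_0^t sign(X_s) dB^(1)_s + \int_0^t lambda dB^(2)_s; both
   integrands are bounded, hence in the scope of is_ito_integral. *)
Definition perturbed_tanaka_solution (R : realType) (d : measure_display)
    (Omega : measurableType d) (P : probability Omega R)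
    (F : R -> set (set Omega)) (B : R -> Omega -> R * R) (lambda : R)
    (X : R -> Omega -> R) : Prop :=
  adapted F X /\ continuous_paths X /\
  exists I1 I2 : R -> Omega -> R,
    is_ito_integral P F (fun t w => (B t w).1) (fun t w => sign (X t w)) I1 /\
    is_ito_integral P F (fun t w => (B t w).2) (fun _ _ => lambda) I2 /\
    {ae P, forall w, forall t : R, 0 <= t -> X t w = X 0 w + I1 t w + I2 t w}.

Definition pathwise_unique (R : realType) (d : measure_display)
    (Omega : measurableType d) (P : probability Omega R)
    (solution : (R -> Omega -> R) -> Prop) : Prop :=
  forall X X' : R -> Omega -> R, solution X -> solution X' ->
    {ae P, forall w, X 0 w = X' 0 w} ->
    {ae P, forall w, forall t : R, 0 <= t -> X t w = X' t w}.

(* Main.v *)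
Require Import Defs.
From HB Require Import structures.
From mathcomp Require Import all_boot all_order all_algebra.
From mathcomp Require Import all_classical all_reals all_analysis.
From mathcomp Require Import measurable_realfun ring lra.
Import Order.TTheory GRing.Theory Num.Theory.
Import numFieldNormedType.Exports.
Local Open Scope classical_set_scope.
Local Open Scope ring_scope.
Set Implicit Arguments.
Unset Strict Implicit.
Unset Printing Implicit Defensive.

(** Let X and X' be two solutions with the same start and D = X - X'. The noise
    lambda dB2 cancels in D, so D moves only while X and X' have different signs.
    With F_e(x) = sqrt (e^2 + x^2), a smooth approximation of |x| with second
    derivative F_e'' = e^2 / (e^2 + x^2)^(3/2), the Ito formula gives
      E|D_t| - e <= 1/2 E int_0^t F_e''(D) (sign X - sign X')^2 ds.
    Sum this over e = 2^-k, k < n. The functions F_e'' telescope ([sum_hyp2]):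
    their sum is at most 8/3 / sqrt (e^2 + D^2), where now e = 2^-n. This is
    integrated against the set of times at which the signs differ, and there
    ([hyp1_gap])
      1 / sqrt (e^2 + D^2) <= (F_e'(X) - F_e'(X')) / (X - X')
                            = int_0^1 F_e''(th X + (1 - th) X') dth.
    Each interpolation Z = th X + (1 - th) X' still contains the full noise
    lambda dB2, so a second use of the Ito formula bounds its occupation integral
      lambda^2 / 2 E int_0^t F_e''(Z) ds <= E|Z_t - Z_0|
    independently of e ([nondegenerate_occupation]); here lambda <> 0 is essential.
    Altogether n E|D_t| <= C with C independent of n, hence D_t = 0 almost surely
    for every t, and path continuity extends this to all t at once. The integral
    over th is replaced by a Riemann sum ([sign_change_bound]), so that only
    finitely many interpolations occur.

    The Ito formula is needed in expectation only, and only for the functions F_e.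
    A linear combination of step integrals has, on every time window free of step
    times, increments xi1 dB1 + xi2 dB2 with coefficients fixed by the past. A
    Taylor expansion, independence of Brownian increments and Gaussian moments
    bound the defect of the formula over such a window by a multiple of its length
    to the power 3/2 ([window_defect]). The defect is additive in the window, so
    repeated halving shows that it vanishes ([elementary_ito]). Since F_e is
    Lipschitz and F_e'' is bounded and Lipschitz, both sides of the formula pass to
    the L2 limits that define the stochastic integrals ([ito_limit_formula]). *)

(** * A smooth approximation of the absolute value *)

Section taylor.
Variable R : realType.
Implicit Types (f g : R -> R) (x y C : R).

Lemma mean_value f g : (forall x : R, is_derive x 1 f (g x)) ->
  forall x y, exists2 c, `|c - x| <= `|y - x| & f y - f x = g c * (y - x).
Proof.
move=> df x y.
have cf a b : {within `[a, b], continuous f}.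
  apply: derivable_within_continuous => z _; exact: ex_derive.
have [xy|yx|->] := ltgtP x y; last by exists y; rewrite ?subrr ?mulr0 ?normr0.
- have [c /[!in_itv]/= /andP[xc cy] E] := MVT xy (fun z _ => df z) (cf _ _).
  by exists c => //; rewrite !gtr0_norm; lra.
- have [c /[!in_itv]/= /andP[xc cy] E] := MVT yx (fun z _ => df z) (cf _ _).
  by exists c; [rewrite !ltr0_norm; lra|lra].
Qed.

Lemma taylor1 f g C : (forall x : R, is_derive x 1 f (g x)) ->
  (forall x y, `|g x - g y| <= C * `|x - y|) ->
  forall x y, `|f y - f x - g x * (y - x)| <= C * `|y - x| ^+ 2.
Proof.
move=> df lipg x y; have [c cx ->] := mean_value df x y.
rewrite -mulrBl normrM expr2 mulrA ler_wpM2r//.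
apply: (le_trans (lipg _ _)).
have [->|cx0] := eqVneq `|c - x| 0.
  have [->|yx0] := eqVneq `|y - x| 0; first by rewrite mulr0.
  rewrite mulr0 mulr_ge0//; have := lipg y x.
  have : 0 < `|y - x| by rewrite lt_neqAle eq_sym yx0 normr_ge0.
  move=> h1 h2; have := le_trans (normr_ge0 _) h2.
  by rewrite pmulr_lge0.
have : 0 < `|c - x| by rewrite lt_neqAle eq_sym cx0 normr_ge0.
move=> h1; have := le_trans (normr_ge0 _) (lipg c x).
by rewrite pmulr_lge0// => C0; rewrite ler_wpM2l.
Qed.

(** The remainder, as a function of the end point, has the first-order remainder
    of [f] as its derivative; so [taylor1] and the mean value theorem bound it. *)
Lemma taylor2 F f g C : 0 <= C -> (forall x : R, is_derive x 1 F (f x)) ->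
  (forall x : R, is_derive x 1 f (g x)) ->
  (forall x y, `|g x - g y| <= C * `|x - y|) ->
  forall x y, `|F y - F x - f x * (y - x) - 2^-1 * g x * (y - x) ^+ 2| <=
    C * `|y - x| ^+ 3.
Proof.
move=> C0 dF df lipg x y.
pose H z := F z - f x * (z - x) - 2^-1 * g x * (z - x) ^+ 2.
have dH (z : R) : is_derive z 1 H (f z - f x - g x * (z - x)).
  have -> : H = F - (fun z => f x *: (z - x)) -
    (fun z => (2^-1 * g x) *: ((z - x) * (z - x))) by [].
  apply: is_derive_eq.
  by rewrite /GRing.scale/= subr0 !mulr1; field.
have [c cx E] := mean_value dH x y.
have -> : F y - F x - f x * (y - x) - 2^-1 * g x * (y - x) ^+ 2 = H y - H x.
  by rewrite /H subrr; ring.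
rewrite E normrM exprSr mulrA ler_wpM2r//.
apply: le_trans (taylor1 df lipg _ _) _.
by rewrite ler_wpM2l// lerXn2r// nnegrE.
Qed.

End taylor.

Section hyp.
Variable R : realType.
Implicit Types (e x y : R).

(** The hypotenuse of a right triangle with legs [e] and [x]: a smooth convex
    function within [e] of the absolute value. [hyp1] and [hyp2] are its first and
    second derivatives in [x]. *)
Definition hyp e x := Num.sqrt (e ^+ 2 + x ^+ 2).
Definition hyp1 e x := x / hyp e x.
Definition hyp2 e x := e ^+ 2 / hyp e x ^+ 3.

Lemma hypE e x : hyp e x ^+ 2 = e ^+ 2 + x ^+ 2.
Proof. by rewrite sqr_sqrtr// addr_ge0// sqr_ge0. Qed.

Lemma hyp_ge0 e x : 0 <= hyp e x. Proof. exact: sqrtr_ge0. Qed.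

Lemma hyp_gt0 e x : 0 < e -> 0 < hyp e x.
Proof. by move=> e0; rewrite sqrtr_gt0 ltr_pwDl ?sqr_ge0// exprn_gt0. Qed.

Lemma le_hyp a b e x : e ^+ 2 + x ^+ 2 <= a ^+ 2 + b ^+ 2 -> hyp e x <= hyp a b.
Proof. by move=> h; rewrite ler_sqrt// addr_ge0 ?sqr_ge0. Qed.

Lemma hyp_ge_norm e x : `|x| <= hyp e x.
Proof. by rewrite -sqrtr_sqr ler_sqrt ?lerDr ?sqr_ge0// addr_ge0 ?sqr_ge0. Qed.

Lemma hyp_ge e x : 0 <= e -> e <= hyp e x.
Proof.
by move=> e0; rewrite -[leLHS]ger0_norm// -sqrtr_sqr ler_sqrt
  ?lerDl ?sqr_ge0// addr_ge0 ?sqr_ge0.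
Qed.

Lemma hyp0 e : 0 <= e -> hyp e 0 = e.
Proof. by move=> e0; rewrite /hyp expr0n/= addr0 sqrtr_sqr ger0_norm. Qed.

Lemma is_derive_hyp e x : 0 < e -> is_derive x 1 (hyp e) (hyp1 e x).
Proof.
move=> e0.
have p : 0 < e ^+ 2 + x ^+ 2 by rewrite ltr_pwDl ?sqr_ge0// exprn_gt0.
pose ds := is_derive1_sqrt p.
have -> : hyp e = Num.sqrt \o (fun y => e ^+ 2 + y ^+ 2) by [].
apply: is_derive_eq.
rewrite /hyp1 -/(hyp e x) /GRing.scale/=.
by have := hyp_gt0 x e0 => h; field; rewrite gt_eqF.
Qed.

Lemma is_derive_hyp1 e x : 0 < e -> is_derive x 1 (hyp1 e) (hyp2 e x).
Proof.
move=> e0; have h0 := hyp_gt0 x e0; have hE := hypE e x.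
have dh := is_derive_hyp x e0.
have hn : hyp e x != 0 by rewrite gt_eqF.
have -> : hyp1 e = (fun x => x) * (fun x => (hyp e x)^-1) by [].
apply: is_derive_eq.
rewrite /GRing.scale/= /hyp2 /hyp1.
have -> : e ^+ 2 = hyp e x ^+ 2 - x ^+ 2 by lra.
by field.
Qed.

Lemma norm_hyp1_le1 e x : 0 < e -> `|hyp1 e x| <= 1.
Proof.
move=> e0; have h0 := hyp_gt0 x e0.
by rewrite normrM normfV (gtr0_norm h0) ler_pdivrMr// mul1r hyp_ge_norm.
Qed.

Lemma hyp2_ge0 e x : 0 <= hyp2 e x.
Proof. by rewrite mulr_ge0 ?sqr_ge0// invr_ge0 exprn_ge0// hyp_ge0. Qed.

Lemma hyp2_le e x : 0 < e -> hyp2 e x <= e^-1.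
Proof.
move=> e0; have h0 := hyp_gt0 x e0; have he := hyp_ge x (ltW e0).
rewrite ler_pdivrMr ?exprn_gt0// ler_pdivlMl// -exprS.
by rewrite lerXn2r// nnegrE ltW.
Qed.

Lemma hyp_lip e x y : 0 < e -> `|hyp e y - hyp e x| <= `|y - x|.
Proof.
move=> e0.
have [c _ ->] := mean_value (fun x => is_derive_hyp x e0) x y.
by rewrite normrM ler_piMl// norm_hyp1_le1.
Qed.

Lemma hyp2_lip e x y : 0 < e -> `|hyp2 e x - hyp2 e y| <= 3 / e ^+ 2 * `|x - y|.
Proof.
move=> e0; have := hyp_lip y x e0.
have [] := (hyp_gt0 x e0, hyp_gt0 y e0).
have [] := (hyp_ge x (ltW e0), hyp_ge y (ltW e0)).
rewrite /hyp2; set r := hyp e x; set s := hyp e y => er es r0 s0 rs.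
have -> : e ^+ 2 / r ^+ 3 - e ^+ 2 / s ^+ 3 =
  (s - r) * (e ^+ 2 * ((r^-1)^+3 * s^-1 + (r^-1)^+2*(s^-1)^+2 + r^-1 *(s^-1)^+3)).
  by field; rewrite !gt_eqF.
rewrite normrM mulrC distrC.
have ie : forall z, e <= z -> 0 <= z^-1 <= e^-1.
  move=> z ez; have z0 := lt_le_trans e0 ez.
  by rewrite invr_ge0 (ltW z0) lef_pV2.
have /andP[r1 r2] := ie _ er; have /andP[s1 s2] := ie _ es.
have P k l : r^-1 ^+ k * s^-1 ^+ l <= e^-1 ^+ (k + l).
  by rewrite exprD ler_pM ?exprn_ge0// lerXn2r// nnegrE invr_ge0 ltW.
rewrite ger0_norm; last by rewrite mulr_ge0 ?sqr_ge0 // !addr_ge0//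
  mulr_ge0 ?exprn_ge0.
apply: ler_pM => //.
  by rewrite mulr_ge0 ?sqr_ge0 // !addr_ge0// mulr_ge0 ?exprn_ge0.
rewrite ler_pdivlMr ?exprn_gt0//.
have := P 3 1; have := P 2 2; have := P 1 3; rewrite !expr1 /= => p1 p2 p3.
rewrite mulrC mulrA -exprD.
have -> : 3 = e ^+ (2 + 2) * (e^-1 ^+ 4 + e^-1 ^+ 4 + e^-1 ^+ 4) :> R.
  by field; rewrite gt_eqF.
by rewrite ler_wpM2l ?exprn_ge0 ?(ltW e0)//; rewrite !addnS !addn0 in p1 p2 p3 *; lra.
Qed.

(** The third-order remainder is what makes the error over a time window of
    length h of order h^(3/2). *)
Lemma hyp_taylor e : 0 < e -> forall x y,
  `|hyp e y - hyp e x - hyp1 e x * (y - x) - 2^-1 * hyp2 e x * (y - x) ^+ 2| <=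
    3 / e ^+ 2 * `|y - x| ^+ 3.
Proof.
move=> e0; apply: taylor2.
- by rewrite divr_ge0// sqr_ge0.
- by move=> x; exact: is_derive_hyp.
- by move=> x; exact: is_derive_hyp1.
- by move=> x y; exact: hyp2_lip.
Qed.

(** As a function of [e], the derivative of [- (hyp e x)^-1] is [hyp2 e x / e], so
    halving [e] changes [(hyp e x)^-1] by about [hyp2 e x]. *)
Lemma hyp2_telescope e x : 0 < e ->
  hyp2 e x <= 8 / 3 * ((hyp (e / 2) x)^-1 - (hyp e x)^-1).
Proof.
move=> e0; have e20 : 0 < e / 2 by rewrite divr_gt0.
have [] := (hyp_gt0 x e0, hyp_gt0 x e20).
have := hypE (e / 2) x; have := hypE e x; rewrite /hyp2.
have : hyp (e/2) x <= hyp e x by apply: le_hyp; rewrite expr_div_n; nra.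
set r := hyp e x; set p := hyp _ x => pr rE pE r0 p0.
have -> : p^-1 - r^-1 = (r ^+ 2 - p ^+ 2) / (p * r * (r + p)).
  by field; rewrite !gt_eqF// addr_gt0.
rewrite rE pE.
have -> : 8 / 3 * ((e ^+ 2 + x ^+ 2 - ((e / 2) ^+ 2 + x ^+ 2)) / (p * r * (r + p)))
  = e ^+ 2 * (2 / (p * r * (r + p))).
  by field; rewrite !gt_eqF// addr_gt0.
rewrite ler_wpM2l ?sqr_ge0// ler_pdivlMr ?mulr_gt0 ?addr_gt0//.
rewrite ler_pdivrMl ?exprn_gt0//.
have : p * r * (r + p) <= r * r * (r + r).
  by rewrite !ler_pM ?mulr_ge0 ?addr_ge0 ?lerD ?(ltW r0) ?(ltW p0)//.
by move=> /le_trans; apply; rewrite !exprSr expr0; nra.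
Qed.

(** The bound is of order 1 / |x| whatever the number [n] of scales: this is where
    the final estimate gains a factor [n]. *)
Lemma sum_hyp2 n x : \sum_(k < n) hyp2 (2^-1 ^+ k) x <= 8 / 3 / hyp (2^-1 ^+ n) x.
Proof.
have -> : 8 / 3 / hyp (2^-1 ^+ n) x =
    8 / 3 * ((hyp (2^-1 ^+ n) x)^-1 - (hyp (2^-1 ^+ 0) x)^-1) + 8 / 3 * (hyp 1 x)^-1.
  by rewrite expr0; ring.
apply: (@le_trans _ _ (8 / 3 * ((hyp (2^-1 ^+ n) x)^-1 - (hyp (2^-1 ^+ 0) x)^-1)));
  last by rewrite lerDl mulr_ge0 ?invr_ge0 ?hyp_ge0.
elim: n => [|n IH]; first by rewrite big_ord0 subrr mulr0.
rewrite big_ord_recr/=.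
have e0 : 0 < 2^-1 ^+ n :> R by rewrite exprn_gt0.
have := hyp2_telescope x e0; rewrite -exprSr; lra.
Qed.

Lemma sum_half n : \sum_(k < n) 2^-1 ^+ k <= 2 :> R.
Proof.
suff : \sum_(k < n) 2^-1 ^+ k = 2 - 2 * 2^-1 ^+ n :> R.
  by move=> ->; rewrite gerBl mulr_ge0// exprn_ge0.
elim: n => [|n IH]; first by rewrite big_ord0 expr0; lra.
by rewrite big_ord_recr/= IH exprSr; field.
Qed.

(** When [x] and [y] lie on different sides of 0, both have absolute value at most
    |x - y|; hence [|hyp1 e x|] is at least [|x| / hyp e (x - y)], likewise for
    [y], and the two contributions add up. *)
Lemma hyp1_gap e x y : 0 < e -> (0 < x) (+) (0 < y) ->
  (hyp e (x - y))^-1 <= (hyp1 e x - hyp1 e y) / (x - y).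
Proof.
move=> e0.
wlog x0 : x y / 0 < x.
  move=> H; case: (ltP 0 x) => x0 /= xy; first by apply: H; rewrite ?x0.
  have -> : (hyp1 e x - hyp1 e y) / (x - y) = (hyp1 e y - hyp1 e x) / (y - x).
    by rewrite -(opprB x) -(opprB (hyp1 e x)) invrN mulrNN.
  have -> : hyp e (x - y) = hyp e (y - x) by rewrite /hyp -opprB sqrrN.
  by apply: H => //; rewrite xy addbC ltNge x0.
rewrite x0 /= -leNgt => y0.
have D0 : 0 < x - y by lra.
rewrite ler_pdivlMr// /hyp1 mulrC mulrBl -mulNr -(opprK (y / _)) -mulNr.
rewrite [leRHS](_ : _ = x / hyp e x + (- y) / hyp e y); last by rewrite mulNr opprK.
apply: lerD.
  rewrite ler_wpM2l ?(ltW x0)// lef_pV2 ?posrE ?hyp_gt0// le_hyp// lerD2l.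
  by rewrite lerXn2r ?nnegrE; lra.
rewrite ler_wpM2l; [by []|by lra|].
rewrite lef_pV2 ?posrE ?hyp_gt0// le_hyp// lerD2l.
by rewrite -sqrrN lerXn2r ?nnegrE; lra.
Qed.

(** A finite substitute for writing the increment of [hyp1] as the integral of
    its derivative along the segment from [y] to [x]. *)
Lemma riemann_hyp2 e x y (N : nat) : 0 < e -> (0 < N)%N ->
  `|hyp1 e x - hyp1 e y - (x - y) * (N%:R^-1 * \sum_(j < N) hyp2 e (j%:R / N%:R * x + (1 - j%:R
    / N%:R) * y))|
  <= 3 / e ^+ 2 * (x - y) ^+ 2 / N%:R.
Proof.
move=> e0 N0.
have Nn : N%:R != 0 :> R by rewrite pnatr_eq0 -lt0n.
pose z j : R := j%:R / N%:R * x + (1 - j%:R / N%:R) * y.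
have zS j : z j.+1 - z j = (x - y) / N%:R by rewrite /z -natr1; field.
have -> : hyp1 e x - hyp1 e y = \sum_(0 <= j < N) (hyp1 e (z j.+1) - hyp1 e (z j)).
  rewrite telescope_sumr//.
  have -> : z N = x by rewrite /z; field.
  by have -> : z 0 = y by rewrite /z; field.
rewrite big_mkord mulrA mulr_sumr -sumrB.
apply: (le_trans (ler_norm_sum _ _ _)).
apply: (@le_trans _ _ (\sum_(j < N) (3 / e ^+ 2 * (x - y) ^+ 2 / N%:R ^+ 2))).
  apply: ler_sum => j _.
  have := taylor1 (fun x => is_derive_hyp1 x e0) (fun x y => hyp2_lip x y e0) (z j) (z j.+1).
  rewrite zS real_normK ?num_real// expr_div_n [hyp2 e (z j) * _]mulrC.
  by rewrite [3 / _ * (_ / _)]mulrA.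
rewrite sumr_const card_ord -[leLHS]mulr_natr.
by rewrite (_ : _ / _ * _ = 3 / e ^+ 2 * (x - y) ^+ 2 / N%:R)//; field; rewrite Nn gt_eqF.
Qed.

(** Combines [hyp1_gap] with a Riemann sum whose error is below 1 when
    |x - y| < 1; for larger |x - y| the left-hand side is at most 1. *)
Lemma sign_change_bound e x y (N : nat) : 0 < e -> (0 < N)%N -> 3 / e ^+ 2 <= N%:R ->
  (0 < x) (+) (0 < y) -> (hyp e (x - y))^-1 <=
   2 + N%:R^-1 * \sum_(j < N) hyp2 e (j%:R / N%:R * x + (1 - j%:R / N%:R) * y).
Proof.
move=> e0 N0 CN sxy.
have N0' : 0 < N%:R :> R by rewrite ltr0n.
set S := _^-1 * _.
have S0 : 0 <= S.
  by rewrite mulr_ge0 ?invr_ge0// sumr_ge0// => j _; exact: hyp2_ge0.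
have [D1|D1] := leP 1 `|x - y|.
  apply: (@le_trans _ _ 1); last lra.
  by rewrite invf_le1 ?hyp_gt0// (le_trans D1)// hyp_ge_norm.
apply: le_trans (hyp1_gap e0 sxy) _.
have D0 : x - y != 0.
  by apply: contraTneq sxy => /eqP; rewrite subr_eq0 => /eqP ->; rewrite addbb.
have := riemann_hyp2 x y e0 N0; rewrite -/S.
set A := hyp1 e x - hyp1 e y => H.
have -> : A / (x - y) = (A - (x - y) * S) / (x - y) + S by field.
rewrite lerD2r (le_trans (ler_norm _))// normrM normfV ler_pdivrMr ?normr_gt0//.
apply: (le_trans H).
have -> : (x - y) ^+ 2 = `|x - y| ^+ 2 by rewrite real_normK ?num_real.
rewrite ler_pdivrMr// [`|x - y| ^+ 2]expr2 mulrA.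
have : 3 / e ^+ 2 * `|x - y| <= N%:R * 2 by rewrite ler_pM ?divr_ge0 ?sqr_ge0//; lra.
by move=> /(ler_wpM2r (normr_ge0 (x - y))); lra.
Qed.
End hyp.

(** * Products of independent random variables *)

Section independent_product.
Context d (T : measurableType d) (R : realType) (P : probability T R).
Variables X Y : T -> R.
Hypotheses (mX : measurable_fun setT X) (mY : measurable_fun setT Y).
Hypothesis indep : forall A A' : set R, measurable A -> measurable A' ->
  (P (X @^-1` A `&` Y @^-1` A') = P (X @^-1` A) * P (Y @^-1` A'))%E.
Hypotheses (iX : P.-integrable setT (EFin \o X)) (iY : P.-integrable setT (EFin \o Y)).

HB.instance Definition _ := isMeasurableFun.Build _ _ _ _ X mX.
HB.instance Definition _ := isMeasurableFun.Build _ _ _ _ Y mY.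
Let Z w := (X w, Y w).
Let mZ : measurable_fun setT Z. Proof. exact: measurable_fun_pair. Qed.
HB.instance Definition _ := isMeasurableFun.Build _ _ _ _ Z mZ.
Let PX := distribution P (X : {mfun T >-> R}).
Let PY := distribution P (Y : {mfun T >-> R}).
Let PZ := distribution P (Z : {mfun T >-> (R * R)%type}).

Let joint C : measurable C -> (PX \x PY)%E C = PZ C.
Proof.
by apply: product_measure_unique => A B mA mB; rewrite -indep.
Qed.

Let f (p : R * R) : R := p.1 * p.2.
Let mf : measurable_fun setT f.
Proof. by apply: measurable_funM; [exact: measurable_fst|exact: measurable_snd]. Qed.

Let iPX : PX.-integrable setT (EFin \o id).
Proof.
by apply: integrable_pushforward => //; exact/measurable_EFinP/measurable_id.
Qed.

Let iPY : PY.-integrable setT (EFin \o id).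
Proof.
by apply: integrable_pushforward => //; exact/measurable_EFinP/measurable_id.
Qed.

Let if12 : (PX \x PY)%E.-integrable setT (EFin \o f).
Proof.
apply/integrable12ltyP; first exact/measurable_EFinP.
have E x : (\int[PY]_y `|(EFin \o f) (x, y)| = `|x|%:E * \int[PY]_y `|y|%:E)%E.
  rewrite -ge0_integralZl//; last by do 2 apply: measurableT_comp => //.
  by apply: eq_integral => y _; rewrite /= /f normrM EFinM.
under eq_integral do rewrite E.
have /integrableP[_ hX] := iPX; have /integrableP[_ hY] := iPY.
rewrite ge0_integralZr//; last exact: integral_ge0.
  by rewrite lte_mul_pinfty ?integral_ge0// ge0_fin_numE ?integral_ge0.
by do 2 apply: measurableT_comp => //.
Qed.

Let ifZ : PZ.-integrable setT (EFin \o f).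
Proof.
have /integrableP[_ h] := if12.
apply/integrableP; split; first exact/measurable_EFinP.
by rewrite (eq_measure_integral (PX \x PY)%E) // => A mA _; exact/esym/joint.
Qed.

(** By uniqueness of product measures the joint law is the product of the laws,
    so this is Tonelli on the plane. *)
Lemma integrableM_indep : P.-integrable setT (EFin \o (X \* Y)).
Proof.
have /integrableP[_ h] := ifZ.
apply/integrableP; split; first exact/measurable_EFinP/measurable_funM.
rewrite ge0_integral_distribution// in h.
by do 2 apply: measurableT_comp => //.
Qed.

Lemma RintegralM_indep :
  \int[P]_w (X w * Y w) = \int[P]_w X w * \int[P]_w Y w.
Proof.
rewrite /Rintegral.
have -> : (\int[P]_w (X w * Y w)%:E = \int[PZ]_p (f p)%:E)%E.
  rewrite integral_distribution//; first exact/measurable_EFinP.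
  exact: integrableM_indep.
rewrite (eq_measure_integral (PX \x PY)%E); last by move=> A mA _; exact/esym/joint.
rewrite -(integral12_prod_meas1 if12)/=.
have E x : (\int[PY]_y (EFin \o f) (x, y) = x%:E * \int[P]_w (Y w)%:E)%E.
  transitivity (\int[PY]_y (x%:E * y%:E))%E.
    by apply: eq_integral => y _; rewrite /= /f EFinM.
  rewrite integralZl//; congr (_ * _)%E.
  by rewrite (@integral_distribution _ _ _ _ _ P _ EFin)//; exact/measurable_EFinP/measurable_id.
pose c := fine (\int[P]_w (Y w)%:E)%E.
have cE : (\int[P]_w (Y w)%:E = c%:E)%E by rewrite fineK//; exact: integrable_fin_num iY.
rewrite cE /=; under eq_integral do rewrite /fubini_F E cE.
rewrite integralZr//= fineM//; last exact: integrable_fin_num iPX.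
by rewrite (@integral_distribution _ _ _ _ _ P _ EFin)//; exact/measurable_EFinP/measurable_id.
Qed.

End independent_product.

(** * Moments of the normal law *)

Section real_inequalities.
Variable R : realType.

Lemma sqr_le_1Dx4 (x : R) : x ^+ 2 <= 1 + x ^+ 4.
Proof.
have := sqr_ge0 (x ^+ 2 - 1); have := sqr_ge0 x.
have -> : (x ^+ 2 - 1) ^+ 2 = x ^+ 4 - 2 * x ^+ 2 + 1 by ring.
lra.
Qed.

Lemma norm_le_1Dsqr (x : R) : `|x| <= 1 + x ^+ 2.
Proof.
have := sqr_ge0 (`|x| - 1); have := real_normK (num_real x).
have := normr_ge0 x; nra.
Qed.

(** Used to extract first-order information from inequalities valid for all
    small parameters. *)
Lemma small_eq0 (a K c : R) : 0 < c ->
  (forall t : R, 0 < t -> t <= c -> `|a| <= K * t) -> a = 0.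
Proof.
move=> c0 h; apply/eqP; rewrite -normr_eq0 eq_le normr_ge0 andbT.
apply/ler_addgt0Pr => e e0; rewrite add0r.
have K0 : 0 < `|K| + 1 by rewrite ltr_wpDl.
pose t := Num.min c (e / (`|K| + 1)).
have t0 : 0 < t by rewrite lt_min c0 divr_gt0.
apply: (le_trans (h t t0 _)); first by rewrite ge_min lexx.
have : t <= e / (`|K| + 1) by rewrite ge_min lexx orbT.
rewrite ler_pdivlMr// => h1; apply: le_trans h1.
by rewrite mulrC ler_wpM2l ?(ltW t0)// (le_trans (ler_norm K))// lerDl.
Qed.

Lemma expR_le_1D2x (u : R) : 0 <= u <= 1 / 2 -> expR u <= 1 + 2 * u.
Proof.
move=> /andP[v0 v1]; have := expR_ge1Dx (- u); rewrite expRN.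
have p := expR_gt0 u; rewrite -[_^-1]mul1r ler_pdivlMr// => h.
have : 0 <= u * (1 - 2 * u) by rewrite mulr_ge0; lra.
nra.
Qed.

End real_inequalities.

Section gaussian_moments.
Variable R : realType.
Local Notation mu := (@lebesgue_measure R).
Variable s : R.
Hypothesis s0 : 0 < s.
Local Notation N := (normal_prob (0 : R) s).

(** The density is a Radon-Nikodym derivative of the normal law, and two such
    derivatives agree almost everywhere. *)
Lemma ge0_integral_normal (f : R -> R) : measurable_fun setT f ->
  (forall x, 0 <= f x) ->
  (\int[N]_x (f x)%:E = \int[mu]_x (f x * normal_pdf 0 s x)%:E)%E.
Proof.
move=> mf f0.
have dom := normal_prob_dominates 0 s.
have g0 := Radon_Nikodym_SigmaFinite.f_ge0 dom.
rewrite -(Radon_Nikodym_SigmaFinite.change_of_variables dom)//; last exact/measurable_EFinP.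
have mg := measurable_int _ (Radon_Nikodym_SigmaFinite.f_integrable dom).
apply: ge0_ae_eq_integral => //.
- by apply: emeasurable_funM => //; exact/measurable_EFinP.
- by apply/measurable_EFinP/measurable_funM => //; exact: measurable_normal_pdf.
- by move=> x _; rewrite mule_ge0// lee_fin.
- by move=> x _; rewrite lee_fin mulr_ge0 ?normal_pdf_ge0.
- under [X in ae_eq _ _ _ X]eq_fun do rewrite EFinM.
  apply: ae_eqe_mul2l.
  apply: integral_ae_eq => //.
  + exact: Radon_Nikodym_SigmaFinite.f_integrable.
  + by apply/measurable_EFinP; exact: measurable_normal_pdf.
  + by move=> E _ mE; rewrite -Radon_Nikodym_SigmaFinite.f_integral.
Qed.

(** Completing the square: an exponential factor only shifts the mean, so the
    Laplace transform reduces to the total mass of another normal density. *)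
Lemma normal_pdf_exp (t x : R) :
  expR (t * x) * normal_pdf 0 s x = expR (t ^+ 2 * s ^+ 2 / 2) * normal_pdf (t * s ^+ 2) s x.
Proof.
rewrite !normal_pdfE ?gt_eqF//= mulrCA [RHS]mulrCA; congr (_ * _).
rewrite /normal_fun -!expRD; congr expR.
by field; rewrite gt_eqF.
Qed.

Lemma normal_mgf (t : R) : (\int[N]_x (expR (t * x))%:E = (expR (t ^+ 2 * s ^+ 2 / 2))%:E)%E.
Proof.
rewrite ge0_integral_normal; last 2 first.
- by apply: measurableT_comp => //; exact: mulrl_measurable.
- by move=> x; exact: expR_ge0.
under eq_integral do rewrite normal_pdf_exp EFinM.
rewrite ge0_integralZl ?integral_normal_pdf ?mule1//.
- by apply/measurable_EFinP; exact: measurable_normal_pdf.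
- by move=> x _; rewrite lee_fin normal_pdf_ge0.
Qed.

(** A Gaussian factor only changes the variance, which turns integrals of
    exponentials of squares into total masses as well. *)
Lemma normal_pdf_exp2 (t x : R) : 0 < t ->
  expR (x ^+ 2 / (s ^+ 2 *+ 2) - x ^+ 2 / (t ^+ 2 *+ 2)) * normal_pdf 0 s x =
  t / s * normal_pdf 0 t x.
Proof.
move=> t0; rewrite !normal_pdfE ?gt_eqF//= mulrCA [RHS]mulrA.
rewrite /normal_fun -!expRD; congr (_ * expR _); last first.
  by rewrite !subr0; field; rewrite !gt_eqF.
have peakE r : 0 < r -> normal_peak r = (r * Num.sqrt (pi *+ 2))^-1 :> R.
  by move=> r0; rewrite /normal_peak -mulrnAr sqrtrM ?sqr_ge0// sqrtr_sqr gtr0_norm.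
rewrite !peakE//.
have : 0 < Num.sqrt (pi *+ 2) :> R by rewrite sqrtr_gt0 mulrn_wgt0// pi_gt0.
by move=> p; field; rewrite !gt_eqF.
Qed.

Lemma normal_gauss (t : R) : 0 < t ->
  (\int[N]_x (expR (x ^+ 2 / (s ^+ 2 *+ 2) - x ^+ 2 / (t ^+ 2 *+ 2)))%:E = (t / s)%:E)%E.
Proof.
move=> t0; rewrite ge0_integral_normal; last 2 first.
- apply: measurableT_comp => //.
  by apply: measurable_funB; apply: measurable_funM => //; exact: exprn_measurable.
- by move=> x; exact: expR_ge0.
under eq_integral do rewrite normal_pdf_exp2// EFinM.
rewrite ge0_integralZl ?integral_normal_pdf ?mule1//.
- by apply/measurable_EFinP; exact: measurable_normal_pdf.
- by move=> x _; rewrite lee_fin normal_pdf_ge0.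
- by rewrite lee_fin divr_ge0// ltW.
Qed.

(** The fourth power is dominated by 32 s^4 exp (x^2 / (4 s^2)), whose integral
    is known from [normal_gauss]. *)
Lemma integral_normal_X4_le : (\int[N]_x (x ^+ 4)%:E <= (64 * s ^+ 4)%:E)%E.
Proof.
(* with t^2 = 2 s^2, the two squares in the exponent differ by x^2 / (4 s^2) *)
pose t := Num.sqrt 2 * s.
have t0 : 0 < t by rewrite mulr_gt0// sqrtr_gt0.
apply: (@le_trans _ _ (\int[N]_x ((32 * s ^+ 4)%:E *
   (expR (x ^+ 2 / (s ^+ 2 *+ 2) - x ^+ 2 / (t ^+ 2 *+ 2)))%:E))%E).
  apply: ge0_le_integral => //.
  - by move=> x _; rewrite lee_fin exprn_even_ge0.
  - by apply/measurable_EFinP; exact: exprn_measurable.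
  - apply/measurable_EFinP; apply: measurable_funM => //.
    apply: measurableT_comp => //.
    by apply: measurable_funB; apply: measurable_funM => //; exact: exprn_measurable.
  - move=> x _; rewrite -EFinM lee_fin.
    have -> : x ^+ 2 / (s ^+ 2 *+ 2) - x ^+ 2 / (t ^+ 2 *+ 2) = (x / (2 * s)) ^+ 2.
      by rewrite /t exprMn sqr_sqrtr//; field; rewrite gt_eqF.
    set y := x / _; have -> : x = y * (2 * s) by rewrite /y; field; rewrite gt_eqF.
    have := expR_ge1Dxn 1 (sqr_ge0 y); rewrite factE/= => h.
    have -> : (y * (2 * s)) ^+ 4 = 32 * s ^+ 4 * ((y ^+ 2) ^+ 2 / 2) by field.
    rewrite ler_wpM2l ?mulr_ge0 ?exprn_ge0 ?(ltW s0)//.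
    by apply: le_trans h; rewrite lerDr.
rewrite ge0_integralZl//; last 2 first.
- apply/measurable_EFinP; apply: measurableT_comp => //.
  by apply: measurable_funB; apply: measurable_funM => //; exact: exprn_measurable.
- by rewrite lee_fin mulr_ge0// exprn_ge0// ltW.
rewrite normal_gauss// -EFinM lee_fin /t mulfK ?gt_eqF//.
have s2 : Num.sqrt 2 <= 2 :> R.
  by rewrite -[leRHS]ger0_norm// -sqrtr_sqr ler_sqrt//; lra.
have s4 : 0 <= s ^+ 4 by rewrite exprn_ge0// ltW.
by have := ler_wpM2l s4 s2; lra.
Qed.

Lemma integrable_normal_X4 : N.-integrable setT (fun x => (x ^+ 4)%:E).
Proof.
apply/integrableP; split; first by apply/measurable_EFinP; exact: exprn_measurable.
apply: (@le_lt_trans _ _ (64 * s ^+ 4)%:E); last exact: ltry.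
apply: le_trans integral_normal_X4_le; rewrite le_eqVlt; apply/orP; left; apply/eqP.
by apply: eq_integral => x _; rewrite abse_EFin ger0_norm// exprn_even_ge0.
Qed.

Lemma normal_moment4 : \int[N]_x x ^+ 4 <= 64 * s ^+ 4.
Proof.
rewrite -lee_fin fineK ?integral_normal_X4_le//.
by apply: integrable_fin_num => //; exact: integrable_normal_X4.
Qed.

Lemma integrable_normal_X2 : N.-integrable setT (fun x => (x ^+ 2)%:E).
Proof.
apply: (@le_integrable _ _ _ N setT measurableT _ (fun x => (1 + x ^+ 4)%:E)).
- by apply/measurable_EFinP; exact: exprn_measurable.
- move=> x _; rewrite !abse_EFin lee_fin !ger0_norm ?sqr_ge0 ?addr_ge0// ?exprn_even_ge0//.
  exact: sqr_le_1Dx4.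
- exact: (integrableD measurableT (finite_measure_integrable_cst _ 1 measurableT)
  integrable_normal_X4).
Qed.

Lemma integrable_normal_X : N.-integrable setT (fun x => x%:E).
Proof.
apply: (@le_integrable _ _ _ N setT measurableT _ (fun x => (1 + x ^+ 2)%:E)).
- by apply/measurable_EFinP; exact: measurable_id.
- move=> x _; rewrite !abse_EFin lee_fin [leRHS]ger0_norm ?addr_ge0 ?sqr_ge0//.
  exact: norm_le_1Dsqr.
- exact: (integrableD measurableT (finite_measure_integrable_cst _ 1 measurableT)
  integrable_normal_X2).
Qed.

Lemma integral_normal1 : (\int[N]_x 1%:E = 1)%E.
Proof. rewrite integral_cst// mul1e; exact: probability_setT. Qed.

(** Integrating 1 + t x <= exp (t x) gives 1 + t m <= exp (t^2 s^2 / 2) for both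
    signs of [t]; to first order in [t] this forces m = 0. *)
Lemma normal_moment1 : \int[N]_x x = 0.
Proof.
pose m := \int[N]_x x.
have mE : (\int[N]_x x%:E = m%:E)%E by rewrite fineK// integrable_fin_num// integrable_normal_X.
have key t : 1 + t * m <= expR (t ^+ 2 * s ^+ 2 / 2).
  rewrite -lee_fin -normal_mgf.
  have -> : (1 + t * m)%:E = (\int[N]_x (1 + t * x)%:E)%E.
    have h : N.-integrable setT (fun x => t%:E * x%:E)%E by
      exact/integrableZl/integrable_normal_X.
    under eq_integral do rewrite EFinD EFinM.
    rewrite integralD//; last exact: finite_measure_integrable_cst.
    rewrite integralZl//; last exact: integrable_normal_X.
    by rewrite integral_normal1 mE.
  apply: le_integral => //; last by move=> x _; rewrite lee_fin expR_ge1Dx.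
  - exact: (integrableD measurableT (finite_measure_integrable_cst _ 1 measurableT)
      (integrableZl measurableT t integrable_normal_X)).
  - apply/integrableP; split.
      by apply/measurable_EFinP; apply: measurableT_comp => //; exact: mulrl_measurable.
    under eq_integral do rewrite abse_EFin ger0_norm ?expR_ge0//.
    by rewrite normal_mgf ltry.
rewrite -/m; apply: (@small_eq0 _ m (s ^+ 2) s^-1); first by rewrite invr_gt0.
move=> t t0 ts; rewrite ler_norml.
have u1 : t ^+ 2 * s ^+ 2 / 2 <= 1 / 2.
  rewrite ler_pM2r// -exprMn expr_le1// ?mulr_ge0 ?(ltW t0) ?(ltW s0)//.
  by rewrite -(mulVf (lt0r_neq0 s0)) ler_pM2r.
have u0 : 0 <= t ^+ 2 * s ^+ 2 / 2 by rewrite divr_ge0// mulr_ge0// sqr_ge0.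
have E1 := expR_le_1D2x (introT andP (conj u0 u1)).
have := key t; have := key (- t); rewrite sqrrN => k1 k2.
have h1 : t * m <= t * (s ^+ 2 * t) by nra.
have h2 : t * - m <= t * (s ^+ 2 * t) by nra.
by rewrite !ler_pM2l// in h1 h2; apply/andP; split; lra.
Qed.

(** Same tangent argument for 1 - y <= exp (- y) with y = r x^2 / (2 s^2): the
    right-hand side integrates to (1 + r)^(-1/2), which is 1 - r/2 to first order,
    and [r] may have both signs. *)
Lemma normal_moment2 : \int[N]_x x ^+ 2 = s ^+ 2.
Proof.
pose m := \int[N]_x x ^+ 2.
have mE : (\int[N]_x (x ^+ 2)%:E = m%:E)%E.
  by rewrite fineK// integrable_fin_num// integrable_normal_X2.
pose q := m / s ^+ 2.
have key r : - 2^-1 <= r <= 2^-1 -> 1 - r * q / 2 <= 1 - r / 2 + r ^+ 2.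
  move=> /andP[r1 r2].
  have R0 : 0 < 1 + r by lra.
  pose v := Num.sqrt (1 + r); have v0 : 0 < v by rewrite sqrtr_gt0.
  have vE : v ^+ 2 = 1 + r by rewrite sqr_sqrtr// ltW.
  have t0 : 0 < s / v by rewrite divr_gt0.
  apply: (@le_trans _ _ (s / v / s)); last first.
    rewrite mulrAC divff ?gt_eqF// mul1r.
    rewrite -(ler_pXn2r (n := 2))//; last 2 first.
      by rewrite nnegrE invr_ge0 ltW.
      by rewrite nnegrE; nra.
    rewrite exprVn vE -[leLHS]mul1r ler_pdivrMr// -subr_ge0.
    have -> : (1 - r / 2 + r ^+ 2) ^+ 2 * (1 + r) - 1 =
      r ^+ 2 * (5 / 4 * (1 + r) + r ^+ 3) by field.
    rewrite mulr_ge0 ?sqr_ge0//.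
    have : - r ^+ 2 / 2 <= r ^+ 3 by rewrite exprS; have := sqr_ge0 r; nra.
    by nra.
  rewrite -lee_fin -normal_gauss//.
  have -> : (1 - r * q / 2)%:E = (\int[N]_x (1 + (- r / (2 * s ^+ 2)) * x ^+ 2)%:E)%E.
    have h : N.-integrable setT (fun x => (- r / (2 * s ^+ 2))%:E * (x ^+ 2)%:E)%E.
      by exact/integrableZl/integrable_normal_X2.
    under eq_integral do rewrite EFinD EFinM.
    rewrite integralD//; last exact: finite_measure_integrable_cst.
    rewrite integralZl//; last exact: integrable_normal_X2.
    rewrite integral_normal1 mE -EFinM -EFinD /q.
    by congr EFin; field; rewrite gt_eqF.
  apply: le_integral => //.
  - exact: (integrableD measurableT (finite_measure_integrable_cst _ 1 measurableT)
      (integrableZl measurableT (- r / (2 * s ^+ 2)) integrable_normal_X2)).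
  - apply/integrableP; split.
      apply/measurable_EFinP; apply: measurableT_comp => //.
      by apply: measurable_funB; apply: measurable_funM => //; exact: exprn_measurable.
    under eq_integral do rewrite abse_EFin ger0_norm ?expR_ge0//.
    by rewrite normal_gauss// ltry.
  - move=> x _; rewrite lee_fin; apply: le_trans (expR_ge1Dx _).
    rewrite le_eqVlt; apply/orP; left; apply/eqP; congr (1 + _).
    rewrite expr_div_n vE; field; rewrite !gt_eqF//.
suff q1 : q - 1 = 0.
  have mq : m = q * s ^+ 2 by rewrite /q divfK// gt_eqF// exprn_gt0.
  by rewrite -/m mq (subr0_eq q1) mul1r.
apply: (@small_eq0 _ _ 2 2^-1) => // r r0 r2; rewrite ler_norml.
have k1 : 1 - r * q / 2 <= 1 - r / 2 + r ^+ 2 by apply: key; lra.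
have k2 : 1 - (- r) * q / 2 <= 1 - (- r) / 2 + (- r) ^+ 2 by apply: key; lra.
have h1 : r * (q - 1) <= r * (2 * r) by nra.
have h2 : r * - (q - 1) <= r * (2 * r) by nra.
by rewrite !ler_pM2l// in h1 h2; apply/andP; split; lra.
Qed.

End gaussian_moments.

(** * Brownian increments and the past *)

Section law.
Context d (T : measurableType d) (R : realType) (P : probability T R).
Variables (Y : T -> R) (mY : measurable_fun setT Y) (Q : probability (measurableTypeR R) R).
Hypothesis lawY : forall A : set R, measurable A -> P (Y @^-1` A) = Q A.
Variables (f : R -> R) (mf : measurable_fun setT f).
Hypothesis iQ : Q.-integrable setT (EFin \o f).
Let mY' : measurable_fun setT (Y : T -> measurableTypeR R). Proof. exact: mY. Qed.
Let Y' : {mfun T >-> measurableTypeR R} :=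
  @mfun_Sub _ _ T (measurableTypeR R) Y (mem_set mY').

Lemma integrable_law : P.-integrable setT (EFin \o (f \o Y)).
Proof.
have /integrableP[_ h] := iQ.
apply/integrableP; split; first exact/measurable_EFinP/measurableT_comp.
rewrite -(@ge0_integral_distribution _ _ _ (measurableTypeR R) _ P Y' (fun y => `|(f y)%:E|)%E)//.
  have -> : (\int[distribution P Y']_y `|(f y)%:E| = \int[Q]_y `|(f y)%:E|)%E.
    by apply: eq_measure_integral => A mA _; exact: lawY.
  done.
by do 2 apply: measurableT_comp => //.
Qed.

Lemma Rintegral_law : \int[P]_w f (Y w) = \int[Q]_y f y.
Proof.
rewrite /Rintegral -(@integral_distribution _ _ _ (measurableTypeR R) _ P Y' (EFin \o f))//.
- congr fine; apply: eq_measure_integral => A mA _; exact: lawY.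
- exact/measurable_EFinP.
- exact: integrable_law.
Qed.
End law.

Section brownian.
Context (R : realType) (d : measure_display) (Omega : measurableType d)
  (P : probability Omega R) (F : R -> set (set Omega)) (B : R -> Omega -> R * R).
Hypotheses (hF : is_filtration F) (hB : brownian_motion2 P F B).

(** Measurability with respect to [F t], kept as a property of preimages so that
    no second measurable structure has to be put on the sample space. *)
Definition past (t : R) (G : Omega -> R) :=
  forall A : set R, measurable A -> F t (G @^-1` A).

Lemma past_measurable t G : 0 <= t -> past t G -> measurable_fun setT G.
Proof.
by move=> t0 pG _ A mA; rewrite setTI; have [_ [h _]] := hF; apply: (h t t0); exact: pG.
Qed.

Lemma past_le s t G : 0 <= s -> s <= t -> past s G -> past t G.
Proof. by move=> s0 st pG A mA; have [_ [_ h]] := hF; apply: (h s t) => //; exact: pG. Qed.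

Lemma measurable_B t : 0 <= t -> measurable_fun setT (B t).
Proof.
move=> t0 _ A mA; rewrite setTI; have [_ [h _]] := hF; apply: (h t t0).
by have [+ _] := hB; apply.
Qed.

Lemma measurable_B1 t : 0 <= t -> measurable_fun setT (fun w => (B t w).1).
Proof. by move=> t0; apply: measurableT_comp (measurable_B t0) => //; exact: measurable_fst. Qed.

Lemma measurable_B2 t : 0 <= t -> measurable_fun setT (fun w => (B t w).2).
Proof. by move=> t0; apply: measurableT_comp (measurable_B t0) => //; exact: measurable_snd. Qed.

Section increment.
Variables (a b : R) (a0 : 0 <= a) (ab : a < b).
Let s := Num.sqrt (b - a).
Let s0 : 0 < s. Proof. by rewrite sqrtr_gt0 subr_gt0. Qed.
Let sE : s ^+ 2 = b - a. Proof. by rewrite sqr_sqrtr// subr_ge0 ltW. Qed.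
Let b0 : 0 <= b. Proof. exact: le_trans (ltW ab). Qed.
Local Notation Nab := (normal_prob (0 : R) s).
Let Y1 w := (B b w).1 - (B a w).1.
Let Y2 w := (B b w).2 - (B a w).2.

Let mY1 : measurable_fun setT Y1.
Proof. by apply: measurable_funB; exact: measurable_B1. Qed.
Let mY2 : measurable_fun setT Y2.
Proof. by apply: measurable_funB; exact: measurable_B2. Qed.

Let law12 A1 A2 : measurable A1 -> measurable A2 ->
  (P (Y1 @^-1` A1 `&` Y2 @^-1` A2) = Nab A1 * Nab A2)%E.
Proof.
move=> m1 m2; have [_ [_ [_ h]]] := hB.
have [_ /(_ (A1 `*` A2) (measurableX m1 m2))] := h a b a0 ab.
by rewrite product_measure1E.
Qed.

Let law1 A : measurable A -> P (Y1 @^-1` A) = Nab A.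
Proof.
move=> mA; have := law12 mA measurableT.
by rewrite preimage_setT setIT (@probability_setT _ _ _ Nab) mule1.
Qed.

Let law2 A : measurable A -> P (Y2 @^-1` A) = Nab A.
Proof.
move=> mA; have := law12 measurableT mA.
by rewrite preimage_setT setTI (@probability_setT _ _ _ Nab) mul1e.
Qed.

Let indep12 A1 A2 : measurable A1 -> measurable A2 ->
  (P (Y1 @^-1` A1 `&` Y2 @^-1` A2) = P (Y1 @^-1` A1) * P (Y2 @^-1` A2))%E.
Proof. by move=> m1 m2; rewrite law12// law1// law2. Qed.

(** The form in which independence of increments is used: a quantity known at
    time [a] is uncorrelated with every integrable function of the increment. *)
Lemma past_indep (G : Omega -> R) (f : R * R -> R) : past a G ->
  P.-integrable setT (EFin \o G) -> measurable_fun setT f ->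
  P.-integrable setT (fun w => (f (Y1 w, Y2 w))%:E) ->
  \int[P]_w (G w * f (Y1 w, Y2 w)) = \int[P]_w G w * \int[P]_w f (Y1 w, Y2 w).
Proof.
move=> pG iG mf iY; apply: RintegralM_indep => //.
- exact: past_measurable pG.
- by apply: measurableT_comp => //; exact: measurable_fun_pair.
- move=> A A' mA mA'; have [_ [_ [_ h]]] := hB.
  have mfA : measurable (f @^-1` A') by rewrite -[X in measurable X]setTI; exact: mf.
  have [/(_ (G @^-1` A) (f @^-1` A') (pG _ mA) mfA) + _] := h a b a0 ab.
  by [].
Qed.

Let X4 : measurable_fun setT (fun x : R => x ^+ 4).
Proof. exact: exprn_measurable. Qed.
Let X2 : measurable_fun setT (fun x : R => x ^+ 2).
Proof. exact: exprn_measurable. Qed.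
Let X1 : measurable_fun setT (fun x : R => x).
Proof. exact: measurable_id. Qed.

Lemma increment1_integrable : [/\ P.-integrable setT (fun w => (Y1 w)%:E),
  P.-integrable setT (fun w => (Y1 w ^+ 2)%:E) & P.-integrable setT (fun w => (Y1 w ^+ 4)%:E)].
Proof.
split.
- exact: (integrable_law mY1 law1 X1 (integrable_normal_X s0)).
- exact: (integrable_law mY1 law1 X2 (integrable_normal_X2 s0)).
- exact: (integrable_law mY1 law1 X4 (integrable_normal_X4 s0)).
Qed.

Lemma increment2_integrable : [/\ P.-integrable setT (fun w => (Y2 w)%:E),
  P.-integrable setT (fun w => (Y2 w ^+ 2)%:E) & P.-integrable setT (fun w => (Y2 w ^+ 4)%:E)].
Proof.
split.
- exact: (integrable_law mY2 law2 X1 (integrable_normal_X s0)).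
- exact: (integrable_law mY2 law2 X2 (integrable_normal_X2 s0)).
- exact: (integrable_law mY2 law2 X4 (integrable_normal_X4 s0)).
Qed.

Lemma increment1_moments : [/\ \int[P]_w Y1 w = 0, \int[P]_w Y1 w ^+ 2 = b - a &
  \int[P]_w Y1 w ^+ 4 <= 64 * (b - a) ^+ 2].
Proof.
split.
- by rewrite (Rintegral_law mY1 law1 X1 (integrable_normal_X s0)) normal_moment1.
- by rewrite (Rintegral_law mY1 law1 X2 (integrable_normal_X2 s0)) normal_moment2.
- rewrite (Rintegral_law mY1 law1 X4 (integrable_normal_X4 s0)) -sE -exprM.
  exact: normal_moment4.
Qed.

Lemma increment2_moments : [/\ \int[P]_w Y2 w = 0, \int[P]_w Y2 w ^+ 2 = b - a &
  \int[P]_w Y2 w ^+ 4 <= 64 * (b - a) ^+ 2].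
Proof.
split.
- by rewrite (Rintegral_law mY2 law2 X1 (integrable_normal_X s0)) normal_moment1.
- by rewrite (Rintegral_law mY2 law2 X2 (integrable_normal_X2 s0)) normal_moment2.
- rewrite (Rintegral_law mY2 law2 X4 (integrable_normal_X4 s0)) -sE -exprM.
  exact: normal_moment4.
Qed.

Lemma increment12 : P.-integrable setT (fun w => (Y1 w * Y2 w)%:E) /\
  \int[P]_w (Y1 w * Y2 w) = 0.
Proof.
have [i1 _ _] := increment1_integrable; have [i2 _ _] := increment2_integrable.
have [m1 _ _] := increment1_moments.
split; first exact: (integrableM_indep mY1 mY2 indep12).
by rewrite (RintegralM_indep mY1 mY2 indep12)// m1 mul0r.
Qed.

End increment.
End brownian.

(** * Joint measurability and integrals over time slabs *)

Section joint.
Context (R : realType) (d : measure_display) (Omega : measurableType d).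
Local Notation OR := (Omega * measurableTypeR R)%type.

(** The time is truncated at 0 because processes carry no information at negative
    times, while Tonelli is applied to functions on the whole product space. *)
Definition jointly_measurable (X : R -> Omega -> R) :=
  measurable_fun setT (fun p : OR => X (Num.max 0 p.2) p.1).

Definition grid (n : nat) (u : R) : R := (Num.truncn (n.+1%:R * u))%:R / n.+1%:R.

Lemma grid_dist n (u : R) : 0 <= u -> `|u - grid n u| <= n.+1%:R^-1.
Proof.
move=> u0.
have n0 : 0 < n.+1%:R :> R by rewrite ltr0n.
have /truncn_itv/andP[h1 h2] : 0 <= n.+1%:R * u by rewrite mulr_ge0.
have gu : grid n u <= u by rewrite /grid ler_pdivrMr// [leRHS]mulrC.
rewrite ger0_norm ?subr_ge0//.
have -> : n.+1%:R^-1 = (grid n u * n.+1%:R + 1) / n.+1%:R - grid n u.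
  by field; rewrite gt_eqF.
rewrite lerD2r ler_pdivlMr// /grid divfK ?gt_eqF// natr1 [leLHS]mulrC.
exact: ltW.
Qed.

Lemma grid_cvg (u : R) : 0 <= u -> grid n u @[n --> \oo] --> u.
Proof.
move=> u0; apply/cvgrPdist_lt => e e0.
near=> n; apply: le_lt_trans (grid_dist n u0) _.
near: n; exact: (near_infty_natSinv_lt (PosNum e0)).
Unshelve. all: by end_near. Qed.

Let mmax : measurable_fun setT (fun p : OR => Num.max 0 p.2 : R).
Proof. by apply: measurable_maxr => //; exact: measurable_snd. Qed.

Lemma continuous_paths_grid (X : R -> Omega -> R) w (u : R) : continuous_paths X -> 0 <= u ->
  X (grid n u) w @[n --> \oo] --> X u w.
Proof.
move=> cX u0; have /subspace_continuousP/(_ _ u0) h := cX w.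
apply: (@cvg_comp _ _ _ (fun n => grid n u) (X ^~ w) _ _ _ _ h).
move=> V hV; apply: (@filterS _ \oo _ _ _ _ (grid_cvg u0 hV)) => n; apply.
by rewrite /= /grid divr_ge0.
Qed.

(** The process frozen at the left end points of a grid is measurable on each
    of countably many strips, and converges to the process by path continuity. *)
Lemma jointly_measurable_continuous (X : R -> Omega -> R) :
  continuous_paths X -> (forall t, 0 <= t -> measurable_fun setT (X t)) ->
  jointly_measurable X.
Proof.
move=> cX mX.
apply: (@measurable_fun_cvg _ _ _ _
  (fun n (p : OR) => X (grid n (Num.max 0 p.2)) p.1)).
- move=> n.
  have n0 : 0 < n.+1%:R :> R by rewrite ltr0n.
  pose E k : set OR := setT `&` (fun p : OR => n.+1%:R * Num.max 0 p.2 : R) @^-1` `[k%:R,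
    k.+1%:R[.
  have -> : [set: OR] = \bigcup_k E k.
    apply/esym; rewrite -subTset => p _.
    exists (Num.truncn (n.+1%:R * Num.max 0 p.2)) => //.
    split => //=; rewrite in_itv/=; apply: truncn_itv.
    by rewrite mulr_ge0// le_max lexx.
  have mE k : measurable (E k).
    by apply: measurable_funM => //; exact: measurable_cst.
  apply/measurable_fun_bigcup => // k.
  apply: (eq_measurable_fun (fun p : OR => X (k%:R / n.+1%:R) p.1)).
    move=> p; rewrite inE => -[_ /=]; rewrite in_itv/= => h.
    by rewrite /grid (truncn_def h).
  apply: measurable_funTS.
  apply: measurableT_comp; last exact: measurable_fst.
  by apply: mX; rewrite divr_ge0.
- by move=> p _; apply: continuous_paths_grid => //; rewrite le_max lexx.
Qed.

Lemma jointly_measurable_min (X : R -> Omega -> R) (t : R) : 0 <= t ->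
  jointly_measurable X -> jointly_measurable (fun u => X (Num.min u t)).
Proof.
move=> t0 mX.
rewrite /jointly_measurable.
have -> : (fun p : OR => X (Num.min (Num.max 0 p.2) t) p.1) =
   (fun p : OR => X (Num.max 0 p.2) p.1) \o (fun p : OR => (p.1,
     Num.min p.2 t : measurableTypeR R)).
  apply/funext => p /=; congr X.
  by rewrite max_minr (max_r t0).
apply: measurableT_comp => //.
apply: measurable_fun_pair; first exact: measurable_fst.
by apply: measurable_minr => //; exact: measurable_snd.
Qed.

End joint.

Section slab.
Context (R : realType) (d : measure_display) (Omega : measurableType d)
  (P : probability Omega R).
Local Notation OR := (Omega * measurableTypeR R)%type.
Local Notation leb := (@lebesgue_measure R).
Local Notation mu := (P \x leb)%E.

(** Half-open in time, as are the intervals on which step processes are constant;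
    so adjacent slabs are disjoint. *)
Definition slab (a b : R) : set OR := setT `*` `]a, b].

Lemma measurable_slab a b : measurable (slab a b).
Proof. by apply: measurableX => //; exact: measurable_itv. Qed.
#[local] Hint Resolve measurable_slab : core.

Lemma slabE a b (p : OR) : slab a b p <-> a < p.2 <= b.
Proof. by rewrite /slab /=; split=> [[_] | h]; [rewrite in_itv | split => //;
  rewrite in_itv]. Qed.

Lemma integral_itv_cst a b (c : R) : a <= b ->
  (\int[leb]_(u in `]a, b]) c%:E = (c * (b - a))%:E)%E.
Proof.
move=> ab; transitivity (c%:E * leb `]a, b]%classic)%E.
  by apply: integral_cst; exact: measurable_itv.
rewrite lebesgue_measure_itv/= lte_fin.
move: ab; rewrite le_eqVlt => /orP[/eqP ->|->].
  by rewrite ltxx subrr mule0 mulr0.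
by rewrite -EFinD -EFinM.
Qed.

Lemma measure_slab a b : a <= b -> mu (slab a b) = (b - a)%:E.
Proof.
move=> ab; rewrite product_measure1E//.
transitivity (1 * leb `]a, b]%classic)%E; first by congr (_ * _)%E; exact: probability_setT.
rewrite mul1e lebesgue_measure_itv/= lte_fin.
by move: ab; rewrite le_eqVlt => /orP[/eqP ->|->//]; rewrite ltxx subrr.
Qed.

Lemma slab_tonelli2 a b (f : OR -> R) : measurable_fun setT f -> (forall p, 0 <= f p) ->
  (\int[mu]_(p in slab a b) (f p)%:E =
   \int[leb]_(u in `]a, b]) \int[P]_w (f (w, u))%:E)%E.
Proof.
move=> mf f0.
rewrite integral_mkcond fubini_tonelli2; last 2 first.
- by apply: (measurable_restrictT _ _).1 => //; apply: measurable_funTS; exact/measurable_EFinP.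
- by move=> p; rewrite patchE; case: ifP; rewrite ?lee_fin.
rewrite [RHS]integral_mkcond; apply: eq_integral => u _.
rewrite /fubini_G patchE; case: ifPn => [uab|nuab].
  apply: eq_integral => w _; rewrite patchE mem_set//.
  by split => //; exact: set_mem.
under eq_integral => w _.
  rewrite patchE memNset; last by move=> [_ /= /mem_set]; apply/negP.
  over.
by rewrite integral0.
Qed.

Lemma slab_tonelli1 a b (f : OR -> R) : measurable_fun setT f -> (forall p, 0 <= f p) ->
  (\int[mu]_(p in slab a b) (f p)%:E =
   \int[P]_w \int[leb]_(u in `]a, b]) (f (w, u))%:E)%E.
Proof.
move=> mf f0.
rewrite integral_mkcond fubini_tonelli1; last 2 first.
- by apply: (measurable_restrictT _ _).1 => //; apply: measurable_funTS; exact/measurable_EFinP.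
- by move=> p; rewrite patchE; case: ifP; rewrite ?lee_fin.
apply: eq_integral => w _.
rewrite /fubini_F [RHS]integral_mkcond; apply: eq_integral => u _.
rewrite !patchE; congr (if _ then _ else _).
apply/idP/idP => [/set_mem[_]//= h|/set_mem h]; first exact: mem_set.
by apply/mem_set; split.
Qed.

Lemma slab_bounded_integrable a b (f : OR -> R) C : a <= b -> measurable_fun setT f ->
  (forall p, slab a b p -> `|f p| <= C) -> mu.-integrable (slab a b) (EFin \o f).
Proof.
move=> ab mf fC; apply: measurable_bounded_integrable => //.
- have h : (mu (slab a b) < +oo)%E by rewrite measure_slab// ltry.
  exact: h.
- exact: measurable_funTS.
- exists C; split; first exact: num_real.
  by move=> x Cx p Dp; apply: (le_trans (fC p Dp)); exact: ltW.
Qed.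

Lemma slab_integral_cst a b (c : R) : a <= b ->
  (\int[mu]_(p in slab a b) c%:E = (c * (b - a))%:E)%E.
Proof.
move=> ab; transitivity (c%:E * mu (slab a b))%E.
  by apply: integral_cst; exact: measurable_slab.
by rewrite measure_slab.
Qed.

Lemma slab_le a b (f : OR -> R) c : a <= b -> measurable_fun setT f -> (forall p, 0 <= f p) ->
  (forall u, a < u <= b -> (\int[P]_w (f (w, u))%:E <= c%:E)%E) ->
  \int[mu]_(p in slab a b) f p <= c * (b - a).
Proof.
move=> ab mf f0 h.
have H : (\int[mu]_(p in slab a b) (f p)%:E <= (c * (b - a))%:E)%E.
  rewrite slab_tonelli2//.
  apply: (@le_trans _ _ (\int[leb]_(u in `]a, b]) c%:E)%E).
    apply: ge0_le_integral => //.
    - by move=> u _; apply: integral_ge0 => w _; rewrite lee_fin.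
    - apply: measurable_funTS.
      apply: (measurable_fun_fubini_tonelli_G (fun p => (f p)%:E)) => //.
      exact/measurable_EFinP.
  by rewrite integral_itv_cst.
rewrite -lee_fin fineK// ge0_fin_numE; first exact: le_lt_trans H (ltry _).
by apply: integral_ge0 => p _; rewrite lee_fin.
Qed.

Lemma slab_cst a b (G : Omega -> R) : a <= b -> measurable_fun setT G -> (forall w, 0 <= G w) ->
  \int[mu]_(p in slab a b) G p.1 = (b - a) * \int[P]_w G w.
Proof.
move=> ab mG G0.
rewrite /Rintegral slab_tonelli1//; last first.
  by apply: measurableT_comp => //; exact: measurable_fst.
have -> : (\int[P]_w \int[leb]_(u in `]a, b]) (G (w, u).1)%:E =
  \int[P]_w ((b - a)%:E * (G w)%:E))%E.
  apply: eq_integral => w _ /=.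
  by rewrite integral_itv_cst// EFinM muleC.
rewrite ge0_integralZl//; first last.
- by rewrite lee_fin subr_ge0.
- by move=> w _; rewrite lee_fin.
- exact/measurable_EFinP.
have i0 : (0 <= \int[P]_w (G w)%:E)%E by apply: integral_ge0 => w _; rewrite lee_fin.
case E : (\int[P]_w (G w)%:E)%E i0 => [r| |]//= _.
rewrite mulr0 mulry; case: sgrP => _; by rewrite ?mul0e ?mul1e ?mulN1e.
Qed.

Lemma slab_cat a b c (f : OR -> R) : a <= c -> c <= b ->
  mu.-integrable (slab a b) (EFin \o f) ->
  \int[mu]_(p in slab a b) f p = \int[mu]_(p in slab a c) f p + \int[mu]_(p in slab c b) f p.
Proof.
move=> ac cb.
have -> : slab a b = slab a c `|` slab c b.
  apply/seteqP; split => p.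
    move=> /slabE/andP[h1 h2]; case: (leP p.2 c) => h; [left|right]; apply/slabE.
      by rewrite h1 h.
    by rewrite h h2.
  move=> [/slabE/andP[h1 h2]|/slabE/andP[h1 h2]]; apply/slabE.
    by rewrite h1 (le_trans h2 cb).
  by rewrite h2 (le_lt_trans ac h1).
move=> i; rewrite Rintegral_setU//.
apply/disj_setPS => p [] /slabE/andP[_ h1] /slabE/andP[h2 _].
by have := lt_le_trans h2 h1; rewrite ltxx.
Qed.

End slab.

(** * Elementary processes *)

Section elementary.
Context (R : realType) (d : measure_display) (Omega : measurableType d)
  (P : probability Omega R) (F : R -> set (set Omega)) (B : R -> Omega -> R * R).
Hypotheses (hF : is_filtration F) (hB : brownian_motion2 P F B).
Local Notation past := (past F).
Local Notation OR := (Omega * measurableTypeR R)%type.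

(** Transfers the closure properties of measurable functions to [past]. *)
Lemma pastP t (G : Omega -> R) : 0 <= t ->
  past t G <-> measurable_fun setT (G : g_sigma_algebraType (F t) -> R).
Proof.
move=> t0; have [/(_ t t0)/sigma_algebra_id E _] := hF.
split => [pG _ A mA|mG A mA]; rewrite ?setTI.
  by apply: sub_sigma_algebra; exact: pG.
rewrite -E -[X in _ X]setTI; exact: mG.
Qed.

Lemma past_comp t (G : Omega -> R) (f : R -> R) : measurable_fun setT f ->
  past t G -> past t (f \o G).
Proof.
by move=> mf pG A mA; rewrite comp_preimage; apply: pG; rewrite -[X in measurable X]setTI;
  exact: mf.
Qed.

Lemma past_cst t (c : R) : 0 <= t -> past t (cst c).
Proof. by move=> t0; apply/pastP => //; exact: measurable_cst. Qed.

Lemma pastD t (G H : Omega -> R) : 0 <= t -> past t G -> past t H -> past t (fun w => G w + H w).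
Proof.
move=> t0 /(pastP _ t0) mG /(pastP _ t0) mH; apply/pastP => //.
exact: measurable_funD mG mH.
Qed.

Lemma pastM t (G H : Omega -> R) : 0 <= t -> past t G -> past t H -> past t (fun w => G w * H w).
Proof.
move=> t0 /(pastP _ t0) mG /(pastP _ t0) mH; apply/pastP => //.
exact: measurable_funM mG mH.
Qed.

Lemma past_sum t (I : Type) (r : seq I) (G : I -> Omega -> R) : 0 <= t ->
  (forall i, past t (G i)) -> past t (fun w => \sum_(i <- r) G i w).
Proof.
move=> t0 pG; apply/pastP => //.
by apply: (@measurable_sum _ (g_sigma_algebraType (F t)) _ _ _ r G) => i; apply/pastP.
Qed.

Lemma past_B1 t : 0 <= t -> past t (fun w => (B t w).1).
Proof.
move=> t0 A mA; have [+ _] := hB => /(_ t t0 (fst @^-1` A)); apply.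
by rewrite -[X in measurable X]setTI; exact: measurable_fst.
Qed.

Lemma past_B2 t : 0 <= t -> past t (fun w => (B t w).2).
Proof.
move=> t0 A mA; have [+ _] := hB => /(_ t t0 (snd @^-1` A)); apply.
by rewrite -[X in measurable X]setTI; exact: measurable_snd.
Qed.

Lemma jointly_measurable_B1 : jointly_measurable (fun t w => (B t w).1).
Proof.
apply: jointly_measurable_continuous; last by move=> t t0; exact: measurable_B1 hB _ _.
have [_ [h _]] := hB => w; have /subspace_continuousP cB := h w.
apply/subspace_continuousP => t t0.
by apply: (@cvg_comp _ _ _ (fun t => B t w) fst); [exact: cB|exact: cvg_fst].
Qed.

Lemma jointly_measurable_B2 : jointly_measurable (fun t w => (B t w).2).
Proof.
apply: jointly_measurable_continuous; last by move=> t t0; exact: measurable_B2 hB _ _.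
have [_ [h _]] := hB => w; have /subspace_continuousP cB := h w.
apply/subspace_continuousP => t t0.
by apply: (@cvg_comp _ _ _ (fun t => B t w) snd); [exact: cB|exact: cvg_snd].
Qed.

(** What is used of a linear combination of step integrals: between consecutive
    times of a finite set, its increments are those of Brownian motion multiplied
    by coefficients known at the start. Since only the existence of the finite set
    is recorded, sums need no common refinement of partitions. *)
Record elementary (Z h1 h2 : R -> Omega -> R) : Prop := Elementary {
  el_past : forall t, 0 <= t -> past t (Z t) ;
  el_joint : jointly_measurable Z ;
  el_joint1 : measurable_fun setT (fun p : OR => h1 p.2 p.1) ;
  el_joint2 : measurable_fun setT (fun p : OR => h2 p.2 p.1) ;
  el_bounded : exists2 M, 0 <= M & forall u w, `|h1 u w| <= M /\ `|h2 u w| <= M ;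
  el_local : exists T : seq R, forall a b, 0 <= a -> a < b ->
    (forall x, x \in T -> ~~ (a < x < b)) ->
    past a (h1 b) /\ past a (h2 b) /\
    (forall u w, a < u -> u <= b ->
      [/\ h1 u w = h1 b w, h2 u w = h2 b w &
      Z u w = Z a w + h1 b w * ((B u w).1 - (B a w).1) + h2 b w * ((B u w).2 - (B a w).2)]) }.

Lemma elementary_cst (Z0 : Omega -> R) : past 0 Z0 ->
  elementary (fun _ => Z0) (fun _ _ => 0) (fun _ _ => 0).
Proof.
move=> p0; split.
- by move=> t t0; apply: past_le p0.
- apply: measurableT_comp; last exact: measurable_fst.
  exact: (past_measurable hF (lexx 0)).
- exact: measurable_cst.
- exact: measurable_cst.
- by exists 0 => // u w; rewrite normr0.
- exists [::] => a b a0 ab _; split; first exact: past_cst.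
  split; first exact: past_cst.
  by move=> u w _ _; rewrite !mul0r !addr0.
Qed.

Lemma elementaryD Z h1 h2 Z' h1' h2' : elementary Z h1 h2 -> elementary Z' h1' h2' ->
  elementary (fun t w => Z t w + Z' t w) (fun t w => h1 t w + h1' t w)
    (fun t w => h2 t w + h2' t w).
Proof.
move=> [p j j1 j2 [M M0 bd] [T l]] [p' j' j1' j2' [M' M0' bd'] [T' l']]; split.
- by move=> t t0; apply: pastD => //; [exact: p|exact: p'].
- exact: measurable_funD j j'.
- exact: measurable_funD j1 j1'.
- exact: measurable_funD j2 j2'.
- exists (M + M'); first exact: addr_ge0.
  move=> u w; have [b1 b2] := bd u w; have [b1' b2'] := bd' u w.
  by split; apply: (le_trans (ler_normD _ _)); exact: lerD.
- exists (T ++ T') => a b a0 ab nT.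
  have [|q1 [q2 q]] := l a b a0 ab; first by move=> x xT; apply: nT; rewrite mem_cat xT.
  have [|q1' [q2' q']] := l' a b a0 ab; first by move=> x xT; apply: nT; rewrite mem_cat xT orbT.
  split; first exact: pastD.
  split; first exact: pastD.
  move=> u w au ub; have [-> -> ->] := q u w au ub; have [-> -> ->] := q' u w au ub.
  by split => //; ring.
Qed.

Lemma elementaryZ (c : R) Z h1 h2 : elementary Z h1 h2 ->
  elementary (fun t w => c * Z t w) (fun t w => c * h1 t w) (fun t w => c * h2 t w).
Proof.
move=> [p j j1 j2 [M M0 bd] [T l]]; split.
- by move=> t t0; apply: pastM => //; [exact: past_cst|exact: p].
- by apply: measurable_funM => //; exact: measurable_cst.
- by apply: measurable_funM => //; exact: measurable_cst.
- by apply: measurable_funM => //; exact: measurable_cst.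
- exists (`|c| * M); first exact: mulr_ge0.
  by move=> u w; have [b1 b2] := bd u w; rewrite !normrM !ler_wpM2l.
- exists T => a b a0 ab nT.
  have [q1 [q2 q]] := l a b a0 ab nT.
  split; first by apply: pastM => //; exact: past_cst.
  split; first by apply: pastM => //; exact: past_cst.
  by move=> u w au ub; have [-> -> ->] := q u w au ub; split => //; ring.
Qed.

Section step.
Variables (W : R -> Omega -> R) (S : step_process R Omega).
Hypotheses (pW : forall t, 0 <= t -> past t (W t)) (jW : jointly_measurable W).
Hypothesis simpleS : simple_process F S.
Local Notation tau := (step_time S).
Local Notation xi := (step_coef S).

Let tau0 i : 0 <= tau i. Proof. by have [/(_ i)/andP[]] := simpleS. Qed.
Let tauS i : tau i <= tau i.+1. Proof. by have [/(_ i)/andP[]] := simpleS. Qed.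
Let pxi i : past (tau i) (xi i). Proof. by have [_ [+ _]] := simpleS; exact. Qed.
Let mxi i : measurable_fun setT (xi i). Proof. exact: past_measurable (pxi i). Qed.

Lemma past_step_integral t : 0 <= t -> past t (step_integral W S t).
Proof.
move=> t0; apply: past_sum => // i.
have [it|ti] : tau i <= t \/ t < tau i by case: leP; [left|right].
  apply: pastM => //; first exact: past_le (pxi i).
  rewrite [X in past t X](_ : _ =
    (fun w => W (Num.min t (tau i.+1)) w + -1 * W (Num.min t (tau i)) w)); last first.
    by apply/funext => w; rewrite mulN1r.
  have pm r : 0 <= r -> past t (W (Num.min t r)).
    by move=> r0; apply: (@past_le _ _ _ F hF (Num.min t r));
      rewrite ?ge_min ?lexx ?le_min ?t0//; apply: pW; rewrite le_min t0.
  apply: pastD => //; first exact: pm.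
  by apply: pastM => //; [exact: past_cst|exact: pm].
rewrite (_ : (fun w => _) = cst 0); first exact: past_cst.
apply/funext => w; rewrite !min_l ?subrr ?mulr0//; first exact: ltW.
by rewrite (le_trans _ (tauS i))// ltW.
Qed.

Lemma jointly_measurable_step_integral : jointly_measurable (step_integral W S).
Proof.
apply: measurable_sum => i.
apply: measurable_funM; first by apply: measurableT_comp => //; exact: measurable_fst.
apply: measurable_funB.
  exact: (jointly_measurable_min (tau0 i.+1) jW).
exact: (jointly_measurable_min (tau0 i) jW).
Qed.

Lemma measurable_step_value : measurable_fun setT (fun p : OR => step_value S p.2 p.1).
Proof.
apply: measurable_sum => i.
apply: measurable_funM; first by apply: measurableT_comp => //; exact: measurable_fst.
rewrite (_ : (fun p : OR => _) = (fun p : OR => \1_(`]tau i, tau i.+1]) (p.2 : R))).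
  apply: measurableT_comp; last exact: measurable_snd.
  exact: measurable_indic.
apply/funext => p; rewrite indicE; congr (nat_of_bool _)%:R.
by apply/idP/idP => h; [apply/mem_set; rewrite /= in_itv|move/set_mem: h; rewrite /= in_itv].
Qed.

Lemma step_value_bounded : exists2 M, 0 <= M & forall u w, `|step_value S u w| <= M.
Proof.
have [_ [_ [M hM]]] := simpleS.
exists (\sum_(i < step_size S) `|M|); first by apply: sumr_ge0.
move=> u w; apply: (le_trans (ler_norm_sum _ _ _)); apply: ler_sum => i _.
rewrite normrM (le_trans (ler_piMr _ _))//.
  by case: (_ < _ <= _); rewrite ?normr1 ?normr0.
by rewrite (le_trans (hM i w))// ler_norm.
Qed.

Definition step_times := [seq tau i | i <- iota 0 (step_size S).+1].

Section window.
Variables (a b : R) (a0 : 0 <= a) (ab : a < b).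
Hypothesis nT : forall x, x \in step_times -> ~~ (a < x < b).

Let out i : (i <= step_size S)%N -> tau i <= a \/ b <= tau i.
Proof.
move=> iS; have : tau i \in step_times by apply: map_f; rewrite mem_iota.
by move=> /nT; rewrite negb_and -!leNgt => /orP[]; [left|right].
Qed.

(** A step interval either ends before the window, contains it, or starts after
    it. *)
Let outs (i : 'I_(step_size S)) : [\/ tau i <= a /\ tau i.+1 <= a,
   tau i <= a /\ b <= tau i.+1 | b <= tau i /\ b <= tau i.+1].
Proof.
have [h1|h1] := out (ltnW (ltn_ord i)); have [h2|h2] := out (ltn_ord i).
- exact: Or31.
- exact: Or32.
- by have := le_trans h1 (le_trans (tauS i) h2); rewrite leNgt ab.
- exact: Or33.
Qed.

Lemma past_step_value : past a (step_value S b).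
Proof.
apply: past_sum => // i.
have [h|h] := boolP (tau i < b <= tau i.+1); last first.
  rewrite (_ : (fun w => _) = cst 0); first exact: past_cst.
  by apply/funext => w; rewrite mulr0.
apply: pastM => //; last exact: past_cst.
apply: past_le (pxi i) => //.
by have [[]|[]|[]] := outs i => //; move: h => /andP[]; lra.
Qed.

Lemma step_value_window u w : a < u -> u <= b -> step_value S u w = step_value S b w.
Proof.
move=> au ub; apply: eq_bigr => i _; congr (_ * (nat_of_bool _)%:R).
by have [[h1 h2]|[h1 h2]|[h1 h2]] := outs i; apply/idP/idP => /andP[h3 h4]; apply/andP; split;
  lra.
Qed.

Lemma step_integral_window u w : a < u -> u <= b ->
  step_integral W S u w = step_integral W S a w + step_value S b w * (W u w - W a w).
Proof.
move=> au ub; rewrite /step_integral /step_value mulr_suml -big_split/=.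
apply: eq_bigr => i _; rewrite -mulrA -mulrDr; congr (_ * _).
have [[h1 h2]|[h1 h2]|[h1 h2]] := outs i.
- rewrite !min_r; try lra.
  have -> : (tau i < b <= tau i.+1) = false by apply/negP => /andP[]; lra.
  by rewrite mul0r addr0.
- rewrite (min_l (x := u)); last lra.
  rewrite (min_r (x := u)); last lra.
  rewrite (min_l (x := a)); last lra.
  rewrite (min_r (x := a)); last lra.
  have -> : (tau i < b <= tau i.+1) = true by apply/andP; split; lra.
  by rewrite mul1r; ring.
- rewrite !min_l; try lra.
  have -> : (tau i < b <= tau i.+1) = false by apply/negP => /andP[]; lra.
  by rewrite !subrr mul0r addr0.
Qed.

End window.
End step.

Lemma elementary_step1 S : simple_process F S ->
  elementary (step_integral (fun t w => (B t w).1) S) (step_value S) (fun _ _ => 0).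
Proof.
move=> hS; split.
- by move=> t t0; apply: past_step_integral => //; exact: past_B1.
- by apply: jointly_measurable_step_integral => //; exact: jointly_measurable_B1.
- exact: measurable_step_value.
- exact: measurable_cst.
- have [M M0 h] := step_value_bounded hS; exists M => // u w.
  by rewrite normr0; split.
- exists (step_times S) => a b a0 ab nT; split; first exact: past_step_value.
  split; first exact: past_cst.
  move=> u w au ub; split => //; first exact: (step_value_window hS ab nT).
  by rewrite mul0r addr0 (step_integral_window _ hS ab nT).
Qed.

Lemma elementary_step2 S : simple_process F S ->
  elementary (step_integral (fun t w => (B t w).2) S) (fun _ _ => 0) (step_value S).
Proof.
move=> hS; split.
- by move=> t t0; apply: past_step_integral => //; exact: past_B2.
- by apply: jointly_measurable_step_integral => //; exact: jointly_measurable_B2.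
- exact: measurable_cst.
- exact: measurable_step_value.
- have [M M0 h] := step_value_bounded hS; exists M => // u w.
  by rewrite normr0; split.
- exists (step_times S) => a b a0 ab nT; split; first exact: past_cst.
  split; first exact: past_step_value.
  move=> u w au ub; split => //; first exact: (step_value_window hS ab nT).
  by rewrite mul0r addr0 (step_integral_window _ hS ab nT).
Qed.

End elementary.

(** * Ito expansion over one time window *)

Section real_lemmas.
Variable R : realType.

Lemma sqr_diff_le (K e x y : R) : 0 < e -> `|y| <= K ->
  `|x ^+ 2 - y ^+ 2| <= (1 + e^-1) * (x - y) ^+ 2 + e * K ^+ 2.
Proof.
move=> e0 yK.
have -> : x ^+ 2 - y ^+ 2 = (x - y) ^+ 2 + 2 * y * (x - y) by ring.
apply: (le_trans (ler_normD _ _)).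
have -> : `|(x - y) ^+ 2| = (x - y) ^+ 2 by rewrite ger0_norm ?sqr_ge0.
have -> : `|2 * y * (x - y)| = 2 * `|y| * `|x - y| by rewrite !normrM (ger0_norm (_ : 0 <= 2)).
have yy : `|y| ^+ 2 <= K ^+ 2 by rewrite lerXn2r// nnegrE// (le_trans (normr_ge0 y)).
have h : 0 <= e^-1 * (e * `|y| - `|x - y|) ^+ 2.
  by rewrite mulr_ge0 ?sqr_ge0// invr_ge0 ltW.
have : e^-1 * (e * `|y| - `|x - y|) ^+ 2 =
  e * `|y| ^+ 2 - 2 * `|y| * `|x - y| + e^-1 * (x - y) ^+ 2.
  have -> : (x - y) ^+ 2 = `|x - y| ^+ 2 by rewrite real_normK ?num_real.
  by field; rewrite gt_eqF.
have := ler_wpM2l (ltW e0) yy.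
lra.
Qed.

Lemma lip_measurable (f : R -> R) C : (forall x y, `|f x - f y| <= C * `|x - y|) ->
  measurable_fun setT f.
Proof.
move=> lip; apply: continuous_measurable_fun => x.
apply/cvgrPdist_lt => e e0; near=> y.
apply: (le_lt_trans (lip _ _)).
apply: (@le_lt_trans _ _ ((`|C| + 1) * `|x - y|)).
  by rewrite ler_wpM2r// (le_trans (ler_norm C))// lerDl.
rewrite mulrC -ltr_pdivlMr ?ltr_wpDl//.
near: y; apply: cvgr_dist_lt; last by rewrite divr_gt0// ltr_wpDl.
exact: cvg_id.
Unshelve. all: by end_near. Qed.

Lemma measurable_hyp (e : R) : 0 < e -> measurable_fun setT (hyp e).
Proof.
move=> e0; apply: (@lip_measurable _ 1) => x y; rewrite mul1r.
exact: hyp_lip.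
Qed.

Lemma hyp1_lip (e x y : R) : 0 < e -> `|hyp1 e x - hyp1 e y| <= e^-1 * `|x - y|.
Proof.
move=> e0; have [c _ ->] := mean_value (fun x => is_derive_hyp1 x e0) y x.
by rewrite normrM ler_wpM2r// ger0_norm ?hyp2_ge0// hyp2_le.
Qed.

Lemma measurable_hyp1 (e : R) : 0 < e -> measurable_fun setT (hyp1 e).
Proof. by move=> e0; apply: lip_measurable => x y; exact: hyp1_lip. Qed.

Lemma measurable_hyp2 (e : R) : 0 < e -> measurable_fun setT (hyp2 e).
Proof. by move=> e0; apply: lip_measurable => x y; exact: hyp2_lip. Qed.

(** The arithmetic-geometric mean inequality with a free scale [s]: it trades
    first moments for second moments, and L1 convergence for L2 convergence. *)
Lemma norm_le_scaled (s y : R) : 0 < s -> `|y| <= 2^-1 * (s + y ^+ 2 / s).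
Proof.
move=> s0; rewrite -subr_ge0.
have -> : 2^-1 * (s + y ^+ 2 / s) - `|y| = (2 * s)^-1 * (s - `|y|) ^+ 2.
  have -> : y ^+ 2 = `|y| ^+ 2 by rewrite real_normK ?num_real.
  by field; rewrite gt_eqF.
by rewrite mulr_ge0 ?sqr_ge0// invr_ge0 mulr_ge0// ltW.
Qed.

Lemma norm3_le_scaled (s y : R) : 0 < s -> `|y| ^+ 3 <= 2^-1 * (s * y ^+ 2 + y ^+ 4 / s).
Proof.
move=> s0; have := ler_wpM2r (sqr_ge0 `|y|) (norm_le_scaled y s0).
rewrite -exprS => /le_trans; apply.
have -> : y ^+ 4 = (y ^+ 2) ^+ 2 by ring.
have -> : y ^+ 2 = `|y| ^+ 2 by rewrite real_normK ?num_real.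
by rewrite le_eqVlt; apply/orP; left; apply/eqP; ring.
Qed.

Lemma cube_sum (x y : R) : 0 <= x -> 0 <= y -> (x + y) ^+ 3 <= 4 * (x ^+ 3 + y ^+ 3).
Proof.
move=> x0 y0; rewrite -subr_ge0.
have -> : 4 * (x ^+ 3 + y ^+ 3) - (x + y) ^+ 3 = 3 * (x + y) * (x - y) ^+ 2 by ring.
by rewrite mulr_ge0 ?sqr_ge0// mulr_ge0// addr_ge0.
Qed.

Lemma combination_norm (M a b x y : R) : `|a| <= M -> `|b| <= M ->
  `|a * x + b * y| <= M * (`|x| + `|y|).
Proof.
move=> aM bM; apply: (le_trans (ler_normD _ _)); rewrite !normrM mulrDr.
by apply: lerD; rewrite ler_wpM2r.
Qed.

Lemma combination_cube (M a b x y s : R) : 0 < s -> `|a| <= M -> `|b| <= M ->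
  `|a * x + b * y| ^+ 3 <=
  2 * M ^+ 3 * (s * x ^+ 2 + s * y ^+ 2 + x ^+ 4 / s + y ^+ 4 / s).
Proof.
move=> s0 aM bM.
have M0 : 0 <= M := le_trans (normr_ge0 _) aM.
apply: (@le_trans _ _ ((M * (`|x| + `|y|)) ^+ 3)).
  rewrite lerXn2r ?nnegrE// ?combination_norm// mulr_ge0// addr_ge0//.
rewrite exprMn.
have h := cube_sum (normr_ge0 x) (normr_ge0 y).
have hx := norm3_le_scaled x s0; have hy := norm3_le_scaled y s0.
have -> : 2 * M ^+ 3 * (s * x ^+ 2 + s * y ^+ 2 + x ^+ 4 / s + y ^+ 4 / s) =
  M ^+ 3 * (4 * (2^-1 * (s * x ^+ 2 + x ^+ 4 / s) + 2^-1 * (s * y ^+ 2 + y ^+ 4 / s))).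
  by field; rewrite gt_eqF.
rewrite ler_wpM2l ?exprn_ge0//; apply: (le_trans h); lra.
Qed.

End real_lemmas.

Section helpers.
Context d (T : measurableType d) (R : realType) (P : probability T R).

Lemma bounded_integrable (G : T -> R) C : measurable_fun setT G ->
  (forall w, `|G w| <= C) -> P.-integrable setT (EFin \o G).
Proof.
move=> mG GC; apply: measurable_bounded_integrable => //.
- have h : (P setT < +oo)%E by rewrite probability_setT ltry.
  exact: h.
- exists C; split; first exact: num_real.
  by move=> x Cx p _; apply: (le_trans (GC p)); exact: ltW.
Qed.

Lemma bounded_mul_integrable (G Y : T -> R) C : measurable_fun setT G ->
  (forall w, `|G w| <= C) -> P.-integrable setT (EFin \o Y) ->
  P.-integrable setT (EFin \o (fun w => G w * Y w)).
Proof.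
move=> mG GC iY; apply: (@integrableMr _ _ _ _ _ measurableT G (EFin \o Y)) => //.
exists C; split; first exact: num_real.
by move=> x Cx p _; apply: (le_trans (GC p)); exact: ltW.
Qed.

Lemma le_integrable_R (f g : T -> R) : measurable_fun setT f ->
  (forall w, `|f w| <= g w) -> P.-integrable setT (EFin \o g) -> P.-integrable setT (EFin \o f).
Proof.
move=> mf fg ig; apply: (@le_integrable _ _ _ P setT measurableT _ (EFin \o g)) => //.
- exact/measurable_EFinP.
- by move=> w _; rewrite /= lee_fin (le_trans (fg w))// ler_norm.
Qed.

Lemma integrableD_R (f g : T -> R) : P.-integrable setT (EFin \o f) ->
  P.-integrable setT (EFin \o g) -> P.-integrable setT (EFin \o (fun w => f w + g w)).
Proof. move=> i1 i2; exact: (integrableD measurableT i1 i2). Qed.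

Lemma integrableB_R (f g : T -> R) : P.-integrable setT (EFin \o f) ->
  P.-integrable setT (EFin \o g) -> P.-integrable setT (EFin \o (fun w => f w - g w)).
Proof. move=> i1 i2; exact: (integrableB measurableT i1 i2). Qed.

Lemma integrableZ_R (c : R) (f : T -> R) : P.-integrable setT (EFin \o f) ->
  P.-integrable setT (EFin \o (fun w => c * f w)).
Proof. move=> i1; exact: (integrableZl measurableT c i1). Qed.

Lemma Rintegral_le_norm (f g : T -> R) : measurable_fun setT f ->
  (forall w, `|f w| <= g w) -> P.-integrable setT (EFin \o g) ->
  `|\int[P]_w f w| <= \int[P]_w g w.
Proof.
move=> mf fg ig; have i_f := le_integrable_R mf fg ig.
apply: (le_trans (le_normr_Rintegral measurableT i_f)).
apply: le_Rintegral => //; exact: integrable_norm.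
Qed.

Lemma Rintegral_cst1 (c : R) : \int[P]_w c = c.
Proof.
rewrite Rintegral_cst// -[RHS]mulr1; congr (_ * _).
by rewrite -[RHS]/(fine 1%E); congr fine; exact: probability_setT.
Qed.

Lemma integral_cst1 (c : R) : (\int[P]_w c%:E = c%:E)%E.
Proof.
transitivity (c%:E * P setT)%E; first exact: integral_cst.
by rewrite probability_setT mule1.
Qed.

Lemma EFin_Rintegral (f : T -> R) : P.-integrable setT (EFin \o f) ->
  (\int[P]_w (f w)%:E)%E = (\int[P]_w f w)%:E.
Proof. by move=> i; rewrite fineK//; exact: integrable_fin_num. Qed.

End helpers.

(** Integrability of explicit linear combinations of integrable functions. *)
Ltac integrable := repeat first [assumption | apply: integrableZ_R | apply: integrableD_R].

Section exact_ito.
Context (R : realType) (d : measure_display) (Omega : measurableType d)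
  (P : probability Omega R) (F : R -> set (set Omega)) (B : R -> Omega -> R * R).
Hypotheses (hF : is_filtration F) (hB : brownian_motion2 P F B).
Local Notation past := (past F).
Local Notation OR := (Omega * measurableTypeR R)%type.
Local Notation leb := (@lebesgue_measure R).
Local Notation mu := (P \x leb)%E.

Variables (Z h1 h2 : R -> Omega -> R) (M e : R).
Hypothesis elZ : elementary F B Z h1 h2.
Hypotheses (M0 : 0 <= M) (hM : forall u w, `|h1 u w| <= M /\ `|h2 u w| <= M) (e0 : 0 < e).

Let mZ t : 0 <= t -> measurable_fun setT (Z t).
Proof. by move=> t0; apply: (past_measurable hF t0); exact: el_past elZ _ t0. Qed.

(** The integrand of the second-order term in the Ito formula for
    [hyp e (Z t)]. *)
Definition ito_density (p : OR) : R :=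
  hyp2 e (Z (Num.max 0 p.2) p.1) * (h1 p.2 p.1 ^+ 2 + h2 p.2 p.1 ^+ 2).

Lemma measurable_ito_density : measurable_fun setT ito_density.
Proof.
apply: measurable_funM.
  by apply: measurableT_comp; [exact: measurable_hyp2|exact: el_joint elZ].
apply: measurable_funD; apply: measurable_funX.
  exact: el_joint1 elZ.
exact: el_joint2 elZ.
Qed.

Let sqM (x : R) : `|x| <= M -> 0 <= x ^+ 2 <= M ^+ 2.
Proof.
move=> xM; rewrite sqr_ge0/= -[x ^+ 2]ger0_norm ?sqr_ge0// normrX.
by rewrite lerXn2r// nnegrE.
Qed.

Lemma ito_density_bounded p : `|ito_density p| <= e^-1 * (2 * M ^+ 2).
Proof.
have [/sqM/andP[a1 a2] /sqM/andP[b1 b2]] := hM p.2 p.1.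
rewrite normrM !ger0_norm ?hyp2_ge0 ?addr_ge0// ler_pM ?hyp2_ge0 ?addr_ge0 ?hyp2_le//.
lra.
Qed.

Lemma ito_density_integrable a b : a <= b -> mu.-integrable (slab a b) (EFin \o ito_density).
Proof.
move=> ab; apply: (slab_bounded_integrable P ab measurable_ito_density) => p _.
exact: ito_density_bounded.
Qed.

Definition ito_defect a b := \int[P]_w (hyp e (Z b w) - hyp e (Z a w)) -
  2^-1 * \int[mu]_(p in slab a b) ito_density p.

Section window.
Variables a b : R.
Hypotheses (a0 : 0 <= a) (ab : a < b).
Hypotheses (p1 : past a (h1 b)) (p2 : past a (h2 b))
  (win : forall u w, a < u -> u <= b ->
      [/\ h1 u w = h1 b w, h2 u w = h2 b w &
      Z u w = Z a w + h1 b w * ((B u w).1 - (B a w).1) + h2 b w * ((B u w).2 - (B a w).2)]).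
Let s := Num.sqrt (b - a).
Let s0 : 0 < s. Proof. by rewrite sqrtr_gt0 subr_gt0. Qed.
Let sE : s ^+ 2 = b - a. Proof. by rewrite sqr_sqrtr// subr_ge0 ltW. Qed.
Let xi1 := h1 b.
Let xi2 := h2 b.
Let x1M w : `|xi1 w| <= M. Proof. by have [] := hM b w. Qed.
Let x2M w : `|xi2 w| <= M. Proof. by have [] := hM b w. Qed.

Lemma window_increment u : a < u -> u <= b ->
  P.-integrable setT (EFin \o (fun w => Z u w - Z a w)) /\
  \int[P]_w `|Z u w - Z a w| <= 2 * M * s.
Proof.
move=> au ub.
have u0 : 0 <= u := le_trans a0 (ltW au).
pose Y1 w := (B u w).1 - (B a w).1; pose Y2 w := (B u w).2 - (B a w).2.
have [i1 i12 _] := increment1_integrable hF hB a0 au.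
have [i2 i22 _] := increment2_integrable hF hB a0 au.
have [_ m12 _] := increment1_moments hF hB a0 au.
have [_ m22 _] := increment2_moments hF hB a0 au.
pose g w := M * (2^-1 * (s + Y1 w ^+ 2 / s) + 2^-1 * (s + Y2 w ^+ 2 / s)).
have gE : g = fun w => M * s + (M * (2^-1 / s) * (Y1 w ^+ 2) + M * (2^-1 / s) * (Y2 w ^+ 2)).
  by apply/funext => w; rewrite /g; field; rewrite gt_eqF.
have mZ' : measurable_fun setT (fun w => Z u w - Z a w).
  by apply: measurable_funB; exact: mZ.
have bd w : `|Z u w - Z a w| <= g w.
  have [_ _ ->] := win w au ub.
  rewrite [X in `|X|](_ : _ = xi1 w * Y1 w + xi2 w * Y2 w); last by rewrite /Y1 /Y2 /xi1 /xi2;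
    ring.
  apply: (le_trans (combination_norm _ _ (x1M w) (x2M w))).
  by rewrite ler_wpM2l// lerD// norm_le_scaled.
have iq1 : P.-integrable setT (EFin \o (fun w => M * (2^-1 / s) * (Y1 w ^+ 2))) by exact:
  integrableZ_R.
have iq2 : P.-integrable setT (EFin \o (fun w => M * (2^-1 / s) * (Y2 w ^+ 2))) by exact:
  integrableZ_R.
have ic : P.-integrable setT (EFin \o (fun _ : Omega => M * s)) by exact:
  finite_measure_integrable_cst.
have ig : P.-integrable setT (EFin \o g).
  by rewrite gE; apply: integrableD_R => //; exact: integrableD_R.
split; first exact: le_integrable_R ig.
apply: (@le_trans _ _ (\int[P]_w g w)).
  apply: le_Rintegral => //; apply: integrable_norm; exact: le_integrable_R ig.
rewrite gE RintegralD//; last exact: integrableD_R.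
rewrite RintegralD// Rintegral_cst1 !RintegralZl// m12 m22.
have us : (u - a) / s <= s by rewrite ler_pdivrMr// -expr2 sE lerB.
rewrite [leLHS](_ : _ = M * s + M * ((u - a) / s)); last by field; rewrite gt_eqF.
have := ler_wpM2l M0 us; lra.
Qed.

Let G1 w := hyp1 e (Z a w) * xi1 w.
Let G2 w := hyp1 e (Z a w) * xi2 w.
Let G11 w := hyp2 e (Z a w) * (xi1 w * xi1 w).
Let G12 w := hyp2 e (Z a w) * (xi1 w * xi2 w).
Let G22 w := hyp2 e (Z a w) * (xi2 w * xi2 w).
Let L := 3 / e ^+ 2.

Let pZ : past a (Z a). Proof. exact: el_past elZ _ a0. Qed.
Let pG1 : past a G1.
Proof. by apply: (pastM hF) => //; apply: past_comp => //; exact: measurable_hyp1. Qed.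
Let pG2 : past a G2.
Proof. by apply: (pastM hF) => //; apply: past_comp => //; exact: measurable_hyp1. Qed.
Let pg : past a (fun w => hyp2 e (Z a w)).
Proof. by apply: past_comp pZ; exact: measurable_hyp2. Qed.
Let pG11 : past a G11.
Proof. by apply: (pastM hF) => //; exact: pastM. Qed.
Let pG12 : past a G12.
Proof. by apply: (pastM hF) => //; exact: pastM. Qed.
Let pG22 : past a G22.
Proof. by apply: (pastM hF) => //; exact: pastM. Qed.

Let G1b w : `|G1 w| <= M.
Proof. by rewrite normrM -[leRHS]mul1r ler_pM// norm_hyp1_le1. Qed.
Let G2b w : `|G2 w| <= M.
Proof. by rewrite normrM -[leRHS]mul1r ler_pM// norm_hyp1_le1. Qed.
Let gb w : `|hyp2 e (Z a w)| <= e^-1.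
Proof. by rewrite ger0_norm ?hyp2_ge0 ?hyp2_le. Qed.
Let G11b w : `|G11 w| <= e^-1 * (M * M).
Proof. by rewrite normrM ler_pM// normrM ler_pM. Qed.
Let G12b w : `|G12 w| <= e^-1 * (M * M).
Proof. by rewrite normrM ler_pM// normrM ler_pM. Qed.
Let G22b w : `|G22 w| <= e^-1 * (M * M).
Proof. by rewrite normrM ler_pM// normrM ler_pM. Qed.

Let pm (G : Omega -> R) : past a G -> measurable_fun setT G.
Proof. exact: past_measurable. Qed.

(** The first-order term vanishes because increments are centred and independent
    of the past; the second-order term has the announced mean because the two
    components are uncorrelated with variance b - a; the remainder is controlled by
    third absolute moments. *)
Lemma window_taylor :
  `|\int[P]_w (hyp e (Z b w) - hyp e (Z a w)) -
    2^-1 * (b - a) * \int[P]_w (G11 w + G22 w)| <= 260 * L * M ^+ 3 * ((b - a) * s).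
Proof.
pose Y1 w := (B b w).1 - (B a w).1; pose Y2 w := (B b w).2 - (B a w).2.
have [i1 i12 i14] := increment1_integrable hF hB a0 ab.
have [i2 i22 i24] := increment2_integrable hF hB a0 ab.
have [m1 m12 m14] := increment1_moments hF hB a0 ab.
have [m2 m22 m24] := increment2_moments hF hB a0 ab.
have [ii mm] := increment12 hF hB a0 ab.
have PI := past_indep hF hB a0 ab.
have mfst : measurable_fun setT (fst : R * R -> R) by exact: measurable_fst.
have msnd : measurable_fun setT (snd : R * R -> R) by exact: measurable_snd.
have iG (G : Omega -> R) C : past a G -> (forall w,
  `|G w| <= C) -> P.-integrable setT (EFin \o G).
  by move=> pG; apply: bounded_integrable; exact: pm.
have E1 : \int[P]_w (G1 w * Y1 w) = 0.
  by rewrite (PI G1 fst pG1 (iG _ _ pG1 G1b) mfst i1) m1 mulr0.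
have E2 : \int[P]_w (G2 w * Y2 w) = 0.
  by rewrite (PI G2 snd pG2 (iG _ _ pG2 G2b) msnd i2) m2 mulr0.
have E11 : \int[P]_w (G11 w * Y1 w ^+ 2) = (b - a) * \int[P]_w G11 w.
  rewrite (PI G11 (fun p => p.1 ^+ 2) pG11 (iG _ _ pG11 G11b) _ i12); last exact: measurable_funX.
  by rewrite m12 mulrC.
have E22 : \int[P]_w (G22 w * Y2 w ^+ 2) = (b - a) * \int[P]_w G22 w.
  rewrite (PI G22 (fun p => p.2 ^+ 2) pG22 (iG _ _ pG22 G22b) _ i22); last exact: measurable_funX.
  by rewrite m22 mulrC.
have E12 : \int[P]_w (G12 w * (Y1 w * Y2 w)) = 0.
  rewrite (PI G12 (fun p => p.1 * p.2) pG12 (iG _ _ pG12 G12b) _ ii); last exact: measurable_funM.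
  by rewrite mm mulr0.
have I1 := bounded_mul_integrable (pm pG1) G1b i1.
have I2 := bounded_mul_integrable (pm pG2) G2b i2.
have I11 := bounded_mul_integrable (pm pG11) G11b i12.
have I22 := bounded_mul_integrable (pm pG22) G22b i22.
have I12 := bounded_mul_integrable (pm pG12) G12b ii.
pose main w := G1 w * Y1 w + G2 w * Y2 w + 2^-1 * (G11 w * Y1 w ^+ 2)
  + G12 w * (Y1 w * Y2 w) + 2^-1 * (G22 w * Y2 w ^+ 2).
have Imain : P.-integrable setT (EFin \o main).
  by integrable.
have Emain : \int[P]_w main w = 2^-1 * (b - a) * \int[P]_w (G11 w + G22 w).
  rewrite !RintegralD//; try by integrable.
  - by rewrite !RintegralZl// E1 E2 E11 E12 E22; ring.
  - exact: iG pG11 G11b.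
  - exact: iG pG22 G22b.
have mhZ t : 0 <= t -> measurable_fun setT (fun w => hyp e (Z t w)).
  by move=> t0; apply: measurableT_comp; [exact: measurable_hyp|exact: mZ].
have mdh : measurable_fun setT (fun w => hyp e (Z b w) - hyp e (Z a w)).
  by apply: measurable_funB; apply: mhZ => //; exact: le_trans (ltW ab).
have [iZ _] := window_increment ab (lexx b).
have idh : P.-integrable setT (EFin \o (fun w => hyp e (Z b w) - hyp e (Z a w))).
  apply: (@le_integrable_R _ _ _ _ _ (fun w => `|Z b w - Z a w|)) => //.
  - by move=> w; exact: hyp_lip.
  - exact: integrable_norm iZ.
rewrite -Emain -RintegralB//.
(* L |dZ|^3 is bounded by bd; with second moments s^2 and fourth moments at most
   64 s^4, bd has mean at most 2 L M^3 (2 s^3 + 128 s^3) = 260 L M^3 s^3 *)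
pose bd w := 2 * L * M ^+ 3 * (s * Y1 w ^+ 2 + s * Y2 w ^+ 2 + s^-1 * Y1 w ^+ 4 + s^-1 * Y2 w
  ^+ 4).
have L0 : 0 <= L by rewrite divr_ge0// sqr_ge0.
have ibd : P.-integrable setT (EFin \o bd).
  by integrable.
have mmain : measurable_fun setT main.
  by have /integrableP[/measurable_EFinP] := Imain.
apply: (@le_trans _ _ (\int[P]_w bd w)).
  apply: Rintegral_le_norm => //; first exact: measurable_funB.
  move=> w; have [_ _ Zb] := win w ab (lexx b).
  have dZ : Z b w - Z a w = xi1 w * Y1 w + xi2 w * Y2 w.
    by rewrite Zb /Y1 /Y2 /xi1 /xi2; ring.
  have := hyp_taylor e0 (Z a w) (Z b w); rewrite -/L.
  rewrite dZ.
  have -> : hyp e (Z b w) - hyp e (Z a w) - hyp1 e (Z a w) * (xi1 w * Y1 w + xi2 w * Y2 w) -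
    2^-1 * hyp2 e (Z a w) * (xi1 w * Y1 w + xi2 w * Y2 w) ^+ 2 =
    hyp e (Z b w) - hyp e (Z a w) - main w.
    by rewrite /main /G1 /G2 /G11 /G12 /G22; field.
  move=> /le_trans; apply.
  apply: (le_trans (ler_wpM2l L0 (combination_cube (Y1 w) (Y2 w) s0 (x1M w) (x2M w)))).
  by rewrite /bd le_eqVlt; apply/orP; left; apply/eqP; ring.
rewrite RintegralZl//; last by integrable.
rewrite !RintegralD//; try by integrable.
rewrite !RintegralZl// m12 m22.
have -> : 260 * L * M ^+ 3 * ((b - a) * s) = 2 * L * M ^+ 3 * (s * (b - a) + s * (b - a) +
   64 * ((b - a) * s) + 64 * ((b - a) * s)) by ring.
have ss : s^-1 * (64 * (b - a) ^+ 2) = 64 * ((b - a) * s).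
  by rewrite -sE; field; rewrite gt_eqF.
have si : 0 <= s^-1 by rewrite invr_ge0 ltW.
apply: ler_wpM2l; first by rewrite mulr_ge0 ?exprn_ge0// mulr_ge0.
rewrite -ss; apply: lerD; last exact: ler_wpM2l.
by apply: lerD; last exact: ler_wpM2l.
Qed.

(** Compared with [window_taylor], it remains to replace [hyp2 e (Z u)] by
    [hyp2 e (Z a)] in the time integral. This costs the Lipschitz constant of
    [hyp2] times the mean displacement over the window, of order sqrt (b - a). *)
Lemma window_defect : `|ito_defect a b| <= 262 * L * M ^+ 3 * ((b - a) * s).
Proof.
have L0 : 0 <= L by rewrite divr_ge0// sqr_ge0.
pose G w := G11 w + G22 w.
have mG : measurable_fun setT G by apply: measurable_funD; exact: pm.
have GE w : G w = hyp2 e (Z a w) * (xi1 w ^+ 2 + xi2 w ^+ 2) by rewrite /G /G11 /G22; ring.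
have G0 w : 0 <= G w by rewrite GE mulr_ge0 ?hyp2_ge0// addr_ge0 ?sqr_ge0.
have Gb w : `|G w| <= e^-1 * (M * M) + e^-1 * (M * M).
  by apply: (le_trans (ler_normD _ _)); exact: lerD.
have cst := slab_cst P (ltW ab) mG G0.
have mGp : measurable_fun setT (fun p : OR => G p.1).
  by apply: measurableT_comp => //; exact: measurable_fst.
have iGp : mu.-integrable (slab a b) (EFin \o (fun p : OR => G p.1)).
  by apply: (slab_bounded_integrable P (ltW ab) mGp) => p _; exact: Gb.
pose f (p : OR) := L * (2 * M ^+ 2) * `|Z (Num.max 0 p.2) p.1 - Z a p.1|.
have mf : measurable_fun setT f.
  apply: measurable_funM => //; apply: measurableT_comp => //.
  apply: measurable_funB; first exact: el_joint elZ.
  by apply: measurableT_comp; [exact: mZ|exact: measurable_fst].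
have K0 : 0 <= L * (2 * M ^+ 2) by rewrite mulr_ge0// mulr_ge0// sqr_ge0.
have f0 p : 0 <= f p by rewrite mulr_ge0.
have Ef u : a < u <= b -> (\int[P]_w (f (w, u))%:E <= (L * (2 * M ^+ 2) * (2 * M * s))%:E)%E.
  move=> /andP[au ub]; have [iZ EZ] := window_increment au ub.
  rewrite /f /= (max_r (le_trans a0 (ltW au))).
  rewrite EFin_Rintegral; last exact/integrableZ_R/integrable_norm.
  rewrite lee_fin RintegralZl//; last exact: integrable_norm iZ.
  by rewrite ler_wpM2l.
have If := slab_le (ltW ab) mf f0 Ef.
have Efin : (\int[mu]_(p in slab a b) (f p)%:E < +oo)%E.
  apply: (@le_lt_trans _ _ (\int[leb]_(u in `]a, b]) (L * (2 * M ^+ 2) * (2 * M * s))%:E)%E).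
    rewrite slab_tonelli2//; apply: ge0_le_integral => //.
    - by move=> u _; apply: integral_ge0 => w _; rewrite lee_fin.
    - apply: measurable_funTS.
      apply: (measurable_fun_fubini_tonelli_G (fun p => (f p)%:E)) => //.
      exact/measurable_EFinP.
  by rewrite integral_itv_cst ?ltry// ltW.
have if_ : mu.-integrable (slab a b) (EFin \o f).
  apply/integrableP; split; first by apply: measurable_funTS; exact/measurable_EFinP.
  rewrite (eq_integral (fun p => (f p)%:E))//.
  by move=> p _; rewrite /= ger0_norm.
have iito := ito_density_integrable (ltW ab).
have D1 : `|\int[mu]_(p in slab a b) ito_density p - (b - a) * \int[P]_w G w| <=
    L * (2 * M ^+ 2) * (2 * M * s) * (b - a).
  rewrite -cst -RintegralB//; last exact: measurable_slab.
  apply: (le_trans _ If).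
  have id : mu.-integrable (slab a b) (EFin \o (fun p : OR => ito_density p - G p.1)).
    by apply: (integrableB _ iito iGp); exact: measurable_slab.
  apply: (le_trans (le_normr_Rintegral (measurable_slab a b) id)).
  apply: le_Rintegral => //; [exact: measurable_slab|exact: integrable_norm|].
  move=> p /slabE/andP[au ub].
  have [h1E h2E _] := win p.1 au ub.
  rewrite /ito_density h1E h2E GE -/xi1 -/xi2 -mulrBl normrM /f mulrAC.
  have [/sqM/andP[u1 u2] /sqM/andP[v1 v2]] := hM b p.1.
  rewrite ler_pM//; last by rewrite ger0_norm ?addr_ge0//; rewrite /xi1 /xi2; lra.
  exact: hyp2_lip.
have D2 := window_taylor; rewrite -/L -/(G _) in D2.
rewrite /ito_defect.
set A := \int[P]_w _; set I := \int[mu]_(p in _) _; set K := \int[P]_w G w in D1 D2 *.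
have -> : A - 2^-1 * I = (A - 2^-1 * (b - a) * K) - 2^-1 * (I - (b - a) * K) by ring.
apply: (le_trans (ler_normB _ _)).
rewrite [`|2^-1 * _|]normrM (ger0_norm (_ : 0 <= 2^-1))//.
have -> : 262 * L * M ^+ 3 * ((b - a) * s) = 260 * L * M ^+ 3 * ((b - a) * s) +
  2^-1 * (L * (2 * M ^+ 2) * (2 * M * s) * (b - a)) by field.
by rewrite lerD// ler_wpM2l.
Qed.

End window.
End exact_ito.

(** * Expected Ito formula for elementary processes *)

Section interval_additivity.
Variable R : realType.

Lemma geometric_eq0 (x K : R) : (forall n, `|x| <= K * (1 / 2 ^+ n)) -> x = 0.
Proof.
move=> h; apply/eqP; rewrite -normr_eq0 eq_le normr_ge0 andbT.
apply/ler_addgt0Pr => e e0; rewrite add0r.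
have K0 : 0 < `|K| + 1 by rewrite ltr_wpDl.
have e1 : 0 < e / (`|K| + 1) by rewrite divr_gt0.
have [n _ /(_ n (leqnn n))/= hn] := near_infty_natSinv_expn_lt (PosNum e1).
apply: (le_trans (h n)).
apply: (@le_trans _ _ ((`|K| + 1) * (1 / 2 ^+ n))).
  by rewrite ler_wpM2r ?divr_ge0// (le_trans (ler_norm K))// lerDl.
by rewrite mulrC -ler_pdivlMr//; exact: ltW.
Qed.

(** Halving an interval n times produces 2^n pieces, each of size 2^(-3n/2)
    relative to the whole, so the total bound decays like 2^(-n/2). *)
Lemma additive_small_eq0 (D : R -> R -> R) (C : R) (Q : R -> R -> Prop) :
  (forall a c b, a < c -> c < b -> Q a b -> [/\ Q a c, Q c b & D a b = D a c + D c b]) ->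
  (forall a b, a < b -> Q a b -> `|D a b| <= C * ((b - a) * Num.sqrt (b - a))) ->
  forall a b, a < b -> Q a b -> D a b = 0.
Proof.
move=> add small.
pose r : R := Num.sqrt 2^-1.
have r2 : r ^+ 2 = 2^-1 by rewrite sqr_sqrtr.
have H n : forall a b, a < b -> Q a b ->
    `|D a b| <= C * ((b - a) * Num.sqrt (b - a)) * r ^+ n.
  elim: n => [|n IH] a b ab qab; first by rewrite expr0 mulr1; exact: small.
  have ac : a < (a + b) / 2 by lra.
  have cb : (a + b) / 2 < b by lra.
  have [q1 q2 ->] := add _ _ _ ac cb qab.
  have := IH _ _ ac q1; have := IH _ _ cb q2.
  have -> : b - (a + b) / 2 = (b - a) * 2^-1 by field.
  have -> : (a + b) / 2 - a = (b - a) * 2^-1 by field.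
  rewrite sqrtrM ?subr_ge0 ?(ltW ab)// -/r => k2 k1.
  apply: (le_trans (ler_normD _ _)); apply: (le_trans (lerD k1 k2)).
  by rewrite exprS le_eqVlt; apply/orP; left; apply/eqP; field.
move=> a b ab q; apply: (@geometric_eq0 _ (C * ((b - a) * Num.sqrt (b - a)))) => n.
by have := H (2 * n)%N a b ab q; rewrite exprM r2 exprVn div1r.
Qed.

(** Lets a statement about windows free of exceptional times spread to all
    intervals by inserting the exceptional times one by one. *)
Lemma interval_principle (T : seq R) (Q : R -> R -> Prop) :
  (forall a b, 0 <= a -> a < b -> (forall x, x \in T -> ~~ (a < x < b)) -> Q a b) ->
  (forall a c b, 0 <= a -> a < c -> c < b -> Q a c -> Q c b -> Q a b) ->
  forall a b, 0 <= a -> a < b -> Q a b.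
Proof.
move=> loc glue; elim: T loc => [|c T IH] loc; first by move=> a b a0 ab; exact: loc.
apply: IH => a b a0 ab nT.
have [/andP[ac cb]|ncab] := boolP (a < c < b); last first.
  by apply: loc => // x; rewrite inE => /predU1P[->|/nT].
have c0 : 0 <= c := le_trans a0 (ltW ac).
apply: (glue a c b) => //; apply: loc => // x; rewrite inE => /predU1P[->|/nT xab].
- by rewrite ltxx andbF.
- by apply: contra xab => /andP[-> xc]; exact: lt_trans cb.
- by rewrite ltxx.
- by apply: contra xab => /andP[cx ->]; rewrite (lt_trans ac cx).
Qed.

End interval_additivity.

Section ito.
Context (R : realType) (d : measure_display) (Omega : measurableType d)
  (P : probability Omega R) (F : R -> set (set Omega)) (B : R -> Omega -> R * R).
Hypotheses (hF : is_filtration F) (hB : brownian_motion2 P F B).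
Local Notation OR := (Omega * measurableTypeR R)%type.
Local Notation leb := (@lebesgue_measure R).
Local Notation mu := (P \x leb)%E.
Variables (Z h1 h2 : R -> Omega -> R).
Hypothesis elZ : elementary F B Z h1 h2.

Let mZ t : 0 <= t -> measurable_fun setT (Z t).
Proof. by move=> t0; apply: (past_measurable hF t0); exact: el_past elZ _ t0. Qed.

Lemma elementary_integrable a b : 0 <= a -> a < b ->
  P.-integrable setT (EFin \o (fun w => Z b w - Z a w)).
Proof.
have [M M0 hM] := el_bounded elZ; have [T loc] := el_local elZ.
move: a b; apply: (@interval_principle _ T).
- move=> a b a0 ab nT; have [p1 [p2 win]] := loc a b a0 ab nT.
  by have [] := window_increment hF hB elZ M0 hM a0 ab win ab (lexx b).
- move=> a c b a0 ac cb i1 i2.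
  rewrite (_ : (fun w => _) = (fun w => (Z c w - Z a w) + (Z b w - Z c w))).
    exact: integrableD_R.
  by apply/funext => w; ring.
Qed.

Lemma hyp_increment_integrable (e a b : R) : 0 < e -> 0 <= a -> a < b ->
  P.-integrable setT (EFin \o (fun w => hyp e (Z b w) - hyp e (Z a w))).
Proof.
move=> e0 a0 ab.
have mhZ t : 0 <= t -> measurable_fun setT (fun w => hyp e (Z t w)).
  by move=> t0; apply: measurableT_comp; [exact: measurable_hyp|exact: mZ].
apply: (@le_integrable_R _ _ _ _ _ (fun w => `|Z b w - Z a w|)).
- by apply: measurable_funB; apply: mhZ => //; exact: le_trans (ltW ab).
- by move=> w; exact: hyp_lip.
- by apply: integrable_norm; exact: elementary_integrable.
Qed.

Lemma ito_defectD (e a c b : R) : 0 < e -> 0 <= a -> a < c -> c < b ->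
  ito_defect P Z h1 h2 e a b = ito_defect P Z h1 h2 e a c + ito_defect P Z h1 h2 e c b.
Proof.
move=> e0 a0 ac cb; have [M M0 hM] := el_bounded elZ.
have c0 : 0 <= c := le_trans a0 (ltW ac).
have ab : a <= b by rewrite (le_trans (ltW ac))// ltW.
rewrite /ito_defect (slab_cat (ltW ac) (ltW cb));
  last exact: (ito_density_integrable P elZ M0 hM e0 ab).
rewrite (_ : \int[P]_w (hyp e (Z b w) - hyp e (Z a w)) =
  \int[P]_w (hyp e (Z c w) - hyp e (Z a w)) + \int[P]_w (hyp e (Z b w) - hyp e (Z c w))).
  by ring.
rewrite -RintegralD//; last 2 first.
- exact: hyp_increment_integrable.
- exact: hyp_increment_integrable.
by apply: eq_Rintegral => w _; ring.
Qed.

Lemma ito_defect_eq0 (e : R) : 0 < e ->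
  forall a b, 0 <= a -> a < b -> ito_defect P Z h1 h2 e a b = 0.
Proof.
move=> e0.
have [M M0 hM] := el_bounded elZ; have [T loc] := el_local elZ.
apply: (@interval_principle _ T); last first.
  by move=> a c b a0 ac cb D1 D2; rewrite (ito_defectD e0 a0 ac cb) D1 D2 addr0.
move=> a b a0 ab nT.
apply: (@additive_small_eq0 _ (ito_defect P Z h1 h2 e) (262 * (3 / e ^+ 2) * M ^+ 3)
  (fun a b => 0 <= a /\ (forall x, x \in T -> ~~ (a < x < b)))) => //.
- move=> {nT ab}{}a c {}b ac cb [{}a0 nT]; split.
  + split => // x xT; apply: contra (nT x xT) => /andP[-> h]; exact: lt_trans cb.
  + split; first exact: le_trans (ltW ac).
    by move=> x xT; apply: contra (nT x xT) => /andP[h ->]; rewrite (lt_trans ac h).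
  + exact: ito_defectD.
- move=> {nT ab}{}a {}b ab [{}a0 nT]; have [p1 [p2 win]] := loc a b a0 ab nT.
  exact: (window_defect hF hB elZ M0 hM e0 a0 ab p1 p2 win).
Qed.

Theorem elementary_ito (e t : R) : 0 < e -> 0 < t ->
  \int[P]_w (hyp e (Z t w) - hyp e (Z 0 w)) =
  2^-1 * \int[mu]_(p in slab 0 t) ito_density Z h1 h2 e p.
Proof.
move=> e0 t0; apply/eqP; rewrite -subr_eq0; apply/eqP.
exact: (ito_defect_eq0 e0 (lexx 0) t0).
Qed.

End ito.

(** * Limits of elementary processes *)

Section ereal_sequences.
Variable R : realType.
Local Open Scope ereal_scope.
Implicit Types u v : nat -> \bar R.

Lemma cvge0_squeeze u v : (forall n, 0 <= u n) -> (forall n, u n <= v n) ->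
  v @ \oo --> 0 -> u @ \oo --> 0.
Proof.
move=> u0 uv v0; apply: (@squeeze_cvge _ _ _ _ (cst 0) u v) => //.
- by apply: nearW => n; rewrite u0 uv.
- exact: cvg_cst.
Qed.

Lemma cvge0Zl u (c : R) : u @ \oo --> 0 -> (fun n => c%:E * u n) @ \oo --> 0.
Proof. by move=> u0; rewrite -[X in _ --> X](mule0 c%:E); exact: cvgeZl. Qed.

Lemma cvge0D u v : u @ \oo --> 0 -> v @ \oo --> 0 -> (fun n => u n + v n) @ \oo --> 0.
Proof.
move=> u0 v0; rewrite -[X in _ --> X](adde0 0).
by apply: cvgeD.
Qed.

(** Typical use: an L1 distance tends to 0 because an L2 distance does. *)
Lemma cvge0_eps u v : (forall n, 0 <= u n) -> (forall n, 0 <= v n) -> v @ \oo --> 0 ->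
  (forall eps : R, (0 < eps)%R -> exists2 C : R, (0 <= C)%R &
    forall n, u n <= eps%:E + C%:E * v n) -> u @ \oo --> 0.
Proof.
move=> u0 vn v0 h.
apply/fine_cvgP.
have half (eps : R) : (0 < eps)%R -> \forall n \near \oo, u n <= eps%:E.
  move=> e0; have e20 : (0 < eps / 2)%R by rewrite divr_gt0.
  have [C C0 uC] := h _ e20.
  have Cv := cvge0Zl C v0.
  have /fine_cvgP[fin /cvgrPdist_le/(_ _ e20)] := Cv.
  move=> cl; near=> n; apply: (le_trans (uC n)).
  have -> : eps%:E = (eps / 2)%:E + (eps / 2)%:E by rewrite -EFinD -splitr.
  apply: leeD2l.
  have fn : C%:E * v n \is a fin_num by near: n.
  rewrite -(fineK fn) lee_fin.
  have : (`|0 - fine (C%:E * v n)| <= eps / 2)%R by near: n.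
  by rewrite sub0r normrN; apply: le_trans; exact: ler_norm.
have fin : \forall n \near \oo, u n \is a fin_num.
  have := half 1%R ltr01; apply: filterS => n un.
  by rewrite ge0_fin_numE// (le_lt_trans un)// ltry.
split => //; apply/cvgrPdist_le => eps e0.
have := half _ e0 => h1; near=> n.
have fn : u n \is a fin_num by near: n.
rewrite sub0r normrN ger0_norm ?fine_ge0//.
rewrite -lee_fin fineK//; near: n; exact: h1.
Unshelve. all: by end_near. Qed.

Lemma cvge0_le0 u (c : R) : u @ \oo --> 0 -> (forall n, c%:E <= u n) -> (c <= 0)%R.
Proof.
move=> u0 cu; rewrite -lee_fin.
apply: (@le_trans _ _ (limn u)); last by rewrite (cvg_lim _ u0).
apply: lime_ge; first by apply/cvg_ex; exists 0.
exact: nearW.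
Qed.

End ereal_sequences.

Section ito_limit.
Context (R : realType) (d : measure_display) (Omega : measurableType d)
  (P : probability Omega R) (F : R -> set (set Omega)) (B : R -> Omega -> R * R).
Hypotheses (hF : is_filtration F) (hB : brownian_motion2 P F B).
Local Notation OR := (Omega * measurableTypeR R)%type.
Local Notation leb := (@lebesgue_measure R).
Local Notation mu := (P \x leb)%E.

Definition L2_limit (h : nat -> R -> Omega -> R) (H : R -> Omega -> R) :=
  forall t, 0 <= t -> (fun n => \int[mu]_(p in slab 0 t)
    ((h n p.2 p.1 - H (Num.max 0 p.2) p.1) ^+ 2)%:E)%E @ \oo --> 0%E.

(** Processes Z with stochastic differential H1 dB1 + H2 dB2 in the L2 sense.
    Unlike solutions of one equation, they are stable under linear combinations,
    which makes the difference and the interpolations of two solutions accessible. *)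
Record ito_limit (Z H1 H2 : R -> Omega -> R) : Prop := ItoLimit {
  il_meas : forall t, 0 <= t -> measurable_fun setT (Z t) ;
  il_joint : jointly_measurable Z ;
  il_joint1 : jointly_measurable H1 ;
  il_joint2 : jointly_measurable H2 ;
  il_bounded : exists2 K, 0 <= K &
    forall u w, 0 <= u -> `|H1 u w| <= K /\ `|H2 u w| <= K ;
  il_approx : exists Zn h1n h2n : nat -> R -> Omega -> R,
    [/\ forall n, elementary F B (Zn n) (h1n n) (h2n n),
        forall n w, Zn n 0 w = Z 0 w,
        forall t, 0 <= t -> (fun n => \int[P]_w `|Zn n t w - Z t w|%:E)%E @ \oo --> 0%E,
        L2_limit h1n H1 & L2_limit h2n H2] }.

Let measurable_diff (h H : R -> Omega -> R) : measurable_fun setT (fun p : OR => h p.2 p.1) ->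
  jointly_measurable H ->
  measurable_fun setT (fun p : OR => h p.2 p.1 - H (Num.max 0 p.2) p.1).
Proof. by move=> mh mH; exact: measurable_funB. Qed.

Lemma L2_limitD (h : nat -> R -> Omega -> R) H (h' : nat -> R -> Omega -> R) H' :
  (forall n, measurable_fun setT (fun p : OR => h n p.2 p.1)) -> jointly_measurable H ->
  (forall n, measurable_fun setT (fun p : OR => h' n p.2 p.1)) -> jointly_measurable H' ->
  L2_limit h H -> L2_limit h' H' ->
  L2_limit (fun n u w => h n u w + h' n u w) (fun u w => H u w + H' u w).
Proof.
move=> mh mH mh' mH' l l' t t0.
apply: (cvge0_squeeze _ _ (cvge0D (cvge0Zl 2 (l t t0)) (cvge0Zl 2 (l' t t0)))) => n.
  by apply: integral_ge0 => p _; rewrite lee_fin sqr_ge0.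
have m1 := measurable_diff (mh n) mH.
have m2 := measurable_diff (mh' n) mH'.
have mslab := measurable_slab (Omega := Omega) (0 : R) t.
have em1 : measurable_fun (slab 0 t)
  (fun p : OR => ((h n p.2 p.1 - H (Num.max 0 p.2) p.1) ^+ 2)%:E).
  by apply: measurable_funTS; apply/measurable_EFinP; exact: measurable_funX.
have em2 : measurable_fun (slab 0 t)
  (fun p : OR => ((h' n p.2 p.1 - H' (Num.max 0 p.2) p.1) ^+ 2)%:E).
  by apply: measurable_funTS; apply/measurable_EFinP; exact: measurable_funX.
rewrite -!ge0_integralZl//; try by move=> p _; rewrite lee_fin sqr_ge0.
rewrite -ge0_integralD//.
- apply: ge0_le_integral => //.
  + by move=> p _; rewrite lee_fin sqr_ge0.
  + apply: measurable_funTS; apply/measurable_EFinP; apply: measurable_funX.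
    by apply: measurable_funB; apply: measurable_funD.
  + by apply: emeasurable_funD; apply: measurable_funeM.
  + move=> p _; rewrite -!EFinM -EFinD lee_fin.
    have sq (a b c e : R) : (a + b - (c + e)) ^+ 2 <= 2 * (a - c) ^+ 2 + 2 * (b - e) ^+ 2.
      by rewrite -subr_ge0; have := sqr_ge0 (a - c - (b - e)); nra.
    exact: sq.
- by move=> p _; rewrite mule_ge0// lee_fin sqr_ge0.
- exact: measurable_funeM.
- by move=> p _; rewrite mule_ge0// lee_fin sqr_ge0.
- exact: measurable_funeM.
Qed.

Lemma L2_limitZ (c : R) (h : nat -> R -> Omega -> R) H :
  (forall n, measurable_fun setT (fun p : OR => h n p.2 p.1)) -> jointly_measurable H ->
  L2_limit h H -> L2_limit (fun n u w => c * h n u w) (fun u w => c * H u w).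
Proof.
move=> mh mH l t t0.
have := cvge0Zl (c ^+ 2) (l t t0); apply: cvg_trans; apply: near_eq_cvg; apply: nearW => n.
rewrite -ge0_integralZl//; first last.
- by rewrite lee_fin sqr_ge0.
- by move=> p _; rewrite lee_fin sqr_ge0.
- apply: measurable_funTS; apply/measurable_EFinP; apply: measurable_funX.
  exact: (measurable_diff (mh n) mH).
- exact: measurable_slab.
by apply: eq_integral => p _; rewrite -EFinM -exprMn mulrBr.
Qed.

Lemma ito_limitD Z H1 H2 Z' H1' H2' : ito_limit Z H1 H2 -> ito_limit Z' H1' H2' ->
  ito_limit (fun t w => Z t w + Z' t w) (fun t w => H1 t w + H1' t w)
    (fun t w => H2 t w + H2' t w).
Proof.
move=> [m j j1 j2 [K K0 bd] [Zn [h1n [h2n [el z0 L1 l1 l2]]]]].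
move=> [m' j' j1' j2' [K' K0' bd'] [Zn' [h1n' [h2n' [el' z0' L1' l1' l2']]]]].
split.
- by move=> t t0; apply: measurable_funD; [exact: m|exact: m'].
- exact: measurable_funD j j'.
- exact: measurable_funD j1 j1'.
- exact: measurable_funD j2 j2'.
- exists (K + K'); first exact: addr_ge0.
  move=> u w u0; have [b1 b2] := bd u w u0; have [b1' b2'] := bd' u w u0.
  by split; apply: (le_trans (ler_normD _ _)); exact: lerD.
- exists (fun n t w => Zn n t w + Zn' n t w), (fun n t w => h1n n t w + h1n' n t w),
    (fun n t w => h2n n t w + h2n' n t w); split.
  + by move=> n; apply: elementaryD.
  + by move=> n w; rewrite z0 z0'.
  + move=> t t0; apply: (cvge0_squeeze _ _ (cvge0D (L1 t t0) (L1' t t0))) => n.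
      by apply: integral_ge0 => w _; rewrite lee_fin.
    have mn : measurable_fun setT (fun w => Zn n t w - Z t w).
      apply: measurable_funB; last exact: m.
      by apply: (past_measurable hF t0); exact: el_past (el n) _ t0.
    have mn' : measurable_fun setT (fun w => Zn' n t w - Z' t w).
      apply: measurable_funB; last exact: m'.
      by apply: (past_measurable hF t0); exact: el_past (el' n) _ t0.
    have en : measurable_fun setT (fun w => `|Zn n t w - Z t w|%:E).
      by apply/measurable_EFinP; apply: measurableT_comp.
    have en' : measurable_fun setT (fun w => `|Zn' n t w - Z' t w|%:E).
      by apply/measurable_EFinP; apply: measurableT_comp.
    rewrite -ge0_integralD//; try by move=> w _; rewrite lee_fin.
    apply: ge0_le_integral => //.
    * apply/measurable_EFinP; apply: measurableT_comp => //.
      rewrite (_ : (fun w => _) = (fun w => (Zn n t w - Z t w) + (Zn' n t w - Z' t w))).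
        exact: measurable_funD.
      by apply/funext => w; ring.
    * exact: emeasurable_funD.
    * move=> w _; rewrite -EFinD lee_fin.
      rewrite (_ : Zn n t w + Zn' n t w - (Z t w + Z' t w) = (Zn n t w - Z t w) + (Zn' n t w -
        Z' t w)); last by ring.
      exact: ler_normD.
  + by apply: L2_limitD => // n; [exact: el_joint1 (el n)|exact: el_joint1 (el' n)].
  + by apply: L2_limitD => // n; [exact: el_joint2 (el n)|exact: el_joint2 (el' n)].
Qed.

Lemma ito_limitZ (c : R) Z H1 H2 : ito_limit Z H1 H2 ->
  ito_limit (fun t w => c * Z t w) (fun t w => c * H1 t w) (fun t w => c * H2 t w).
Proof.
move=> [m j j1 j2 [K K0 bd] [Zn [h1n [h2n [el z0 L1 l1 l2]]]]].
split.
- by move=> t t0; apply: measurable_funM => //; exact: m.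
- by apply: measurable_funM => //.
- by apply: measurable_funM => //.
- by apply: measurable_funM => //.
- exists (`|c| * K); first exact: mulr_ge0.
  by move=> u w u0; have [b1 b2] := bd u w u0; rewrite !normrM !ler_wpM2l.
- exists (fun n t w => c * Zn n t w), (fun n t w => c * h1n n t w),
    (fun n t w => c * h2n n t w); split.
  + by move=> n; apply: elementaryZ.
  + by move=> n w; rewrite z0.
  + move=> t t0.
    have := cvge0Zl `|c| (L1 t t0); apply: cvg_trans; apply: near_eq_cvg; apply: nearW => n.
    rewrite -ge0_integralZl//; first last.
    * apply/measurable_EFinP; apply: measurableT_comp => //.
      apply: measurable_funB; last exact: m.
      by apply: (past_measurable hF t0); exact: el_past (el n) _ t0.
    by apply: eq_integral => w _; rewrite -EFinM -normrM mulrBr.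
  + by apply: L2_limitZ => // n; exact: el_joint1 (el n).
  + by apply: L2_limitZ => // n; exact: el_joint2 (el n).
Qed.

End ito_limit.

(** * Expected Ito formula for the limits *)

Section limit_formula.
Context (R : realType) (d : measure_display) (Omega : measurableType d)
  (P : probability Omega R) (F : R -> set (set Omega)) (B : R -> Omega -> R * R).
Hypotheses (hF : is_filtration F) (hB : brownian_motion2 P F B).
Local Notation OR := (Omega * measurableTypeR R)%type.
Local Notation leb := (@lebesgue_measure R).
Local Notation mu := (P \x leb)%E.

Section data.
Variables (Z H1 H2 : R -> Omega -> R) (Zn h1n h2n : nat -> R -> Omega -> R) (K e t : R).
Hypotheses (mZ : forall t, 0 <= t -> measurable_fun setT (Z t))
  (jZ : jointly_measurable Z) (j1 : jointly_measurable H1) (j2 : jointly_measurable H2).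
Hypotheses (K0 : 0 <= K) (HK : forall u w, 0 <= u -> `|H1 u w| <= K /\ `|H2 u w| <= K).
Hypotheses (el : forall n, elementary F B (Zn n) (h1n n) (h2n n))
  (Z0 : forall n w, Zn n 0 w = Z 0 w)
  (L1 : forall t, 0 <= t -> (fun n => \int[P]_w `|Zn n t w - Z t w|%:E)%E @ \oo --> 0%E)
  (l1 : L2_limit P h1n H1) (l2 : L2_limit P h2n H2).
Hypotheses (e0 : 0 < e) (t0 : 0 < t).

Let pos_max (u : R) : 0 <= Num.max 0 u. Proof. by rewrite le_max lexx. Qed.
Let mslab : measurable (slab (Omega := Omega) 0 t). Proof. exact: measurable_slab. Qed.
Let mZn n u : 0 <= u -> measurable_fun setT (Zn n u).
Proof. by move=> u0; apply: (past_measurable hF u0); exact: el_past (el n) _ u0. Qed.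

Definition limit_density (p : OR) : R :=
  hyp2 e (Z (Num.max 0 p.2) p.1) *
  (H1 (Num.max 0 p.2) p.1 ^+ 2 + H2 (Num.max 0 p.2) p.1 ^+ 2).

Let q p : R := H1 (Num.max 0 p.2) p.1 ^+ 2 + H2 (Num.max 0 p.2) p.1 ^+ 2.
Let qn n (p : OR) : R := h1n n p.2 p.1 ^+ 2 + h2n n p.2 p.1 ^+ 2.
Let g (p : OR) : R := hyp2 e (Z (Num.max 0 p.2) p.1).
Let gn n (p : OR) : R := hyp2 e (Zn n (Num.max 0 p.2) p.1).

Let mq : measurable_fun setT q.
Proof. by apply: measurable_funD; apply: measurable_funX; [exact: j1|exact: j2]. Qed.
Let mqn n : measurable_fun setT (qn n).
Proof.
apply: measurable_funD; apply: measurable_funX; first exact: el_joint1 (el n).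
exact: el_joint2 (el n).
Qed.
Let mg : measurable_fun setT g.
Proof. by apply: measurableT_comp; [exact: measurable_hyp2|exact: jZ]. Qed.
Let mgn n : measurable_fun setT (gn n).
Proof. by apply: measurableT_comp; [exact: measurable_hyp2|exact: el_joint (el n)]. Qed.
Let emabs (f : OR -> R) D : measurable_fun setT f -> measurable_fun D (fun p => `|f p|%:E).
Proof.
move=> mf; apply: measurable_funTS; apply/measurable_EFinP.
by apply: measurableT_comp.
Qed.
Let q_le p : `|q p| <= 2 * K ^+ 2.
Proof.
have [b1 b2] := HK p.1 (pos_max p.2).
rewrite ger0_norm ?addr_ge0 ?sqr_ge0//.
have s (x : R) : `|x| <= K -> x ^+ 2 <= K ^+ 2.
  by move=> xK; rewrite -[x ^+ 2]ger0_norm ?sqr_ge0// normrX lerXn2r// nnegrE.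
by rewrite mulr2n mulrDl mul1r lerD// s.
Qed.

(** Uses |x^2 - y^2| <= (1 + 1/c) (x - y)^2 + c K^2 for |y| <= K, with [c] small
    enough for the constant term to integrate to at most [eps]. *)
Let q_cvg : (fun n => \int[mu]_(p in slab 0 t) `|qn n p - q p|%:E)%E @ \oo --> 0%E.
Proof.
apply: (cvge0_eps _ _ (cvge0D (l1 (ltW t0)) (l2 (ltW t0)))).
- by move=> n; apply: integral_ge0 => p _; rewrite lee_fin.
- by move=> n; rewrite adde_ge0//; apply: integral_ge0 => p _; rewrite lee_fin sqr_ge0.
move=> eps eps0.
pose c := eps / (2 * K ^+ 2 * t + 1).
have den : 0 < 2 * K ^+ 2 * t + 1.
  by rewrite ltr_wpDl// mulr_ge0 ?(ltW t0)// mulr_ge0// sqr_ge0.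
have c0 : 0 < c by rewrite divr_gt0.
exists (1 + c^-1); first by rewrite addr_ge0// invr_ge0 ltW.
move=> n.
pose d1 (p : OR) : R := (h1n n p.2 p.1 - H1 (Num.max 0 p.2) p.1) ^+ 2.
pose d2 (p : OR) : R := (h2n n p.2 p.1 - H2 (Num.max 0 p.2) p.1) ^+ 2.
have md1 : measurable_fun (slab 0 t) (fun p => (d1 p)%:E).
  apply: measurable_funTS; apply/measurable_EFinP; apply: measurable_funX.
  by apply: measurable_funB; [exact: el_joint1 (el n)|exact: j1].
have md2 : measurable_fun (slab 0 t) (fun p => (d2 p)%:E).
  apply: measurable_funTS; apply/measurable_EFinP; apply: measurable_funX.
  by apply: measurable_funB; [exact: el_joint2 (el n)|exact: j2].
have d10 p : slab 0 t p -> (0 <= (d1 p)%:E)%E by move=> _; rewrite lee_fin sqr_ge0.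
have d20 p : slab 0 t p -> (0 <= (d2 p)%:E)%E by move=> _; rewrite lee_fin sqr_ge0.
have C0 : 0 <= 1 + c^-1 by rewrite addr_ge0// invr_ge0 ltW.
have ccst : (\int[mu]_(p in slab 0 t) (2 * c * K ^+ 2)%:E <= eps%:E)%E.
  rewrite slab_integral_cst ?(ltW t0)// lee_fin subr0.
  have -> : 2 * c * K ^+ 2 * t = eps * ((2 * K ^+ 2 * t) / (2 * K ^+ 2 * t + 1)).
    by rewrite /c; field; rewrite gt_eqF.
  by rewrite ler_piMr ?(ltW eps0)// ler_pdivrMr// mul1r lerDl.
apply: (le_trans _ (leeD2r _ ccst)).
rewrite -ge0_integralD// -ge0_integralZl//; first last.
- by move=> p dp; rewrite adde_ge0// ?d10 ?d20.
- exact: emeasurable_funD.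
rewrite -ge0_integralD//; first last.
- by apply: measurable_funeM; exact: emeasurable_funD.
- by move=> p dp; rewrite mule_ge0// ?adde_ge0// ?d10 ?d20.
- by move=> p _; rewrite lee_fin mulr_ge0 ?sqr_ge0// mulr_ge0// ltW.
apply: ge0_le_integral => //.
- by apply: emabs; exact: measurable_funB.
- apply: emeasurable_funD => //.
  by apply: measurable_funeM; exact: emeasurable_funD.
- move=> p _; rewrite [X in (_ <= X)%E](_ : _ =
    (2 * c * K ^+ 2 + (1 + c^-1) * (d1 p + d2 p))%:E)//.
  rewrite lee_fin.
  have [b1 b2] := HK p.1 (pos_max p.2).
  have s1 := sqr_diff_le (h1n n p.2 p.1) c0 b1.
  have s2 := sqr_diff_le (h2n n p.2 p.1) c0 b2.
  have -> : qn n p - q p = (h1n n p.2 p.1 ^+ 2 - H1 (Num.max 0 p.2) p.1 ^+ 2) +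
     (h2n n p.2 p.1 ^+ 2 - H2 (Num.max 0 p.2) p.1 ^+ 2) by rewrite /qn /q; ring.
  apply: (le_trans (ler_normD _ _)); apply: (le_trans (lerD s1 s2)).
  by rewrite /d1 /d2 le_eqVlt; apply/orP; left; apply/eqP; ring.
Qed.

(** At each time the convergence follows from the Lipschitz property of [hyp2] and
    the L1 convergence of [Zn]; as [hyp2] is bounded, dominated convergence in time
    needs no uniform control of the approximations. *)
Let g_cvg : (fun n => \int[mu]_(p in slab 0 t) `|gn n p - g p|%:E)%E @ \oo --> 0%E.
Proof.
have tE n : (\int[mu]_(p in slab 0 t) `|gn n p - g p|%:E =
  \int[leb]_(u in `]0%R, t]) \int[P]_w `|gn n (w, u) - g (w, u)|%:E)%E.
  rewrite slab_tonelli2//.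
  by apply: measurableT_comp => //; exact: measurable_funB.
under eq_fun do rewrite tE.
have h01 (x : R) : 0 <= hyp2 e x <= e^-1 by rewrite hyp2_ge0 hyp2_le.
have mgu n (u : R) : measurable_fun setT (fun w => gn n (w, u) - g (w, u)).
  have m1 : measurable_fun setT (hyp2 e \o Zn n (Num.max 0 u)).
    by apply: measurableT_comp; [exact: measurable_hyp2|exact: mZn].
  have m2 : measurable_fun setT (hyp2 e \o Z (Num.max 0 u)).
    by apply: measurableT_comp; [exact: measurable_hyp2|exact: mZ].
  exact: (measurable_funB m1 m2).
have bound (n : nat) (u : R) : (\int[P]_w `|gn n (w, u) - g (w, u)|%:E <= (e^-1)%:E)%E.
  apply: (@le_trans _ _ (\int[P]_w (e^-1)%:E)%E).
    apply: ge0_le_integral => //.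
    - by apply/measurable_EFinP; apply: measurableT_comp.
    - move=> w _; rewrite lee_fin /gn /g.
      have /andP[a1 a2] := h01 (Zn n (Num.max 0 u) w).
      have /andP[b1 b2] := h01 (Z (Num.max 0 u) w).
      by rewrite ler_norml; apply/andP; split; move: a1 a2 b1 b2; lra.
  by rewrite integral_cst1.
have gL n (u : R) : 0 <= u -> (\int[P]_w `|gn n (w, u) - g (w, u)|%:E <=
    (3 / e ^+ 2)%:E * \int[P]_w `|Zn n u w - Z u w|%:E)%E.
  move=> u0; have mD : measurable_fun setT (fun w => Zn n u w - Z u w).
    by apply: measurable_funB; [exact: mZn|exact: mZ].
  rewrite -ge0_integralZl//; first last.
  - by rewrite lee_fin divr_ge0// sqr_ge0.
  - by apply/measurable_EFinP; apply: measurableT_comp.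
  apply: ge0_le_integral => //.
  - by apply/measurable_EFinP; apply: measurableT_comp.
  - by apply: measurable_funeM; apply/measurable_EFinP; apply: measurableT_comp.
  - by move=> w _; rewrite -EFinM lee_fin /gn /g /= (max_r u0) hyp2_lip.
pose fn n (u : measurableTypeR R) := (\int[P]_w `|gn n (w, u) - g (w, u)|%:E)%E.
have fn0 n u : (0 <= fn n u)%E by apply: integral_ge0 => w _; rewrite lee_fin.
have mfn n : measurable_fun `]0%R, t] (fn n).
  apply: measurable_funTS.
  apply: (measurable_fun_fubini_tonelli_G (fun p : OR => `|gn n p - g p|%:E)) => //.
  by apply/measurable_EFinP; apply: measurableT_comp => //; exact: measurable_funB.
have cfn (u : measurableTypeR R) : `]0%R, t]%classic u -> fn ^~ u @ \oo --> 0%E.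
  rewrite /= in_itv/= => /andP[/ltW u0 _].
  apply: (cvge0_squeeze _ _ (cvge0Zl (3 / e ^+ 2) (L1 u0))) => n //.
  exact: gL.
have ic : leb.-integrable `]0%R, t] (cst (e^-1)%:E).
  apply/integrableP; split; first exact: measurable_cst.
  rewrite (eq_integral (fun=> (e^-1)%:E)) ?integral_itv_cst ?ltry ?ltW// => u _.
  by rewrite abse_EFin ger0_norm// invr_ge0 ltW.
have bnd (u : measurableTypeR R) n : `]0%R, t]%classic u -> (`|fn n u| <= (e^-1)%:E)%E.
  by move=> _; rewrite gee0_abs ?fn0//; exact: bound.
have [_ _] := @dominated_convergence _ _ _ leb `]0%R, t] (measurable_itv _)
  fn (cst 0%E) (cst (e^-1)%:E) mfn (measurable_cst _) (aeW _ cfn) ic (aeW _ bnd).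
by rewrite integral0.
Qed.

Let dens_n n (p : OR) : R := ito_density (Zn n) (h1n n) (h2n n) e p.

Let limit_density_bounded p : `|limit_density p| <= e^-1 * (2 * K ^+ 2).
Proof.
rewrite normrM ler_pM//; last exact: q_le.
by rewrite ger0_norm ?hyp2_ge0 ?hyp2_le.
Qed.

Lemma measurable_limit_density : measurable_fun setT limit_density.
Proof. exact: (measurable_funM mg mq). Qed.

Lemma limit_density_integrable : mu.-integrable (slab 0 t) (EFin \o limit_density).
Proof.
apply: (slab_bounded_integrable P (ltW t0) measurable_limit_density) => p _.
exact: limit_density_bounded.
Qed.

Let dens_integrable n : mu.-integrable (slab 0 t) (EFin \o dens_n n).
Proof.
have [M M0 hM] := el_bounded (el n).
exact: (ito_density_integrable P (el n) M0 hM e0 (ltW t0)).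
Qed.

Let dens_cvg : (fun n => \int[mu]_(p in slab 0 t) `|dens_n n p - limit_density p|%:E)%E @ \oo
  --> 0%E.
Proof.
apply: (cvge0_squeeze _ _ (cvge0D (cvge0Zl e^-1 q_cvg) (cvge0Zl (2 * K ^+ 2) g_cvg))) => n.
  by apply: integral_ge0 => p _; rewrite lee_fin.
have m1 : measurable_fun (slab 0 t) (fun p => `|qn n p - q p|%:E).
  by apply: emabs; exact: measurable_funB.
have m2 : measurable_fun (slab 0 t) (fun p => `|gn n p - g p|%:E).
  by apply: emabs; exact: measurable_funB.
have i0 : 0 <= e^-1 by rewrite invr_ge0 ltW.
have k0 : 0 <= 2 * K ^+ 2 by rewrite mulr_ge0// sqr_ge0.
rewrite -!ge0_integralZl//; try by move=> p _; rewrite lee_fin.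
rewrite -ge0_integralD//; first last.
- exact: measurable_funeM.
- by move=> p _; rewrite mule_ge0// lee_fin.
- exact: measurable_funeM.
- by move=> p _; rewrite mule_ge0// lee_fin.
apply: ge0_le_integral => //.
- apply: emabs; apply: measurable_funB; last exact: measurable_limit_density.
  exact: measurable_ito_density (el n) e0.
- by apply: emeasurable_funD; exact: measurable_funeM.
- move=> p _; rewrite -!EFinM -EFinD lee_fin.
  have -> : dens_n n p - limit_density p = gn n p * (qn n p - q p) + (gn n p - g p) * q p.
    by rewrite /dens_n /ito_density /limit_density -/(gn n p) -/(g p) -/(q p) -/(qn n p); ring.
  apply: (le_trans (ler_normD _ _)).
  rewrite (normrM (gn n p)) (normrM (gn n p - g p)); apply: lerD.
    by apply: ler_wpM2r => //; rewrite /gn ger0_norm ?hyp2_ge0 ?hyp2_le.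
  by rewrite mulrC; apply: ler_wpM2r.
Qed.

Lemma limit_increment_integrable : P.-integrable setT (EFin \o (fun w => Z t w - Z 0 w)).
Proof.
have /fine_cvgP[[n _ /(_ n (leqnn n))/= fin] _] := L1 (ltW t0).
have i1 : P.-integrable setT (EFin \o (fun w => Zn n t w - Z t w)).
  apply/integrableP; split.
    apply/measurable_EFinP; apply: measurable_funB; [exact/mZn/ltW|exact/mZ/ltW].
  by rewrite -ge0_fin_numE// integral_ge0.
have i2 := elementary_integrable hF hB (el n) (lexx 0) t0.
rewrite (_ : (fun w => _) = (fun w => (Zn n t w - Zn n 0 w) - (Zn n t w - Z t w))).
  exact: integrableB_R.
by apply/funext => w; rewrite Z0; ring.
Qed.

(** Both sides differ from those of [elementary_ito] for the n-th approximation by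
    quantities tending to 0. *)
Lemma limit_ito : \int[P]_w (hyp e (Z t w) - hyp e (Z 0 w)) =
  2^-1 * \int[mu]_(p in slab 0 t) limit_density p.
Proof.
have t0' := ltW t0.
apply/eqP; rewrite -subr_eq0 -normr_eq0 eq_le normr_ge0 andbT.
apply: (cvge0_le0 (cvge0D (L1 t0') (cvge0Zl 2^-1 dens_cvg))) => n.
set An := (\int[P]_w _)%E; set Bn := (\int[mu]_(p in _) _)%E.
have An0 : (0 <= An)%E by apply: integral_ge0 => w _; rewrite lee_fin.
have Bn0 : (0 <= Bn)%E by apply: integral_ge0 => p _; rewrite lee_fin.
(* an infinite distance An may occur for finitely many n; the bound is then void *)
have [An_oo|An_lt] := eqVneq An +oo%E.
  by rewrite An_oo addye ?leey// gt_eqF// (lt_le_trans (ltNyr 0))// mule_ge0// lee_fin.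
have mhyp (Y : Omega -> R) : measurable_fun setT Y -> measurable_fun setT (fun w => hyp e (Y w)).
  by move=> mY; apply: measurableT_comp => //; exact: measurable_hyp.
have i1 : P.-integrable setT (EFin \o (fun w => Zn n t w - Z t w)).
  apply/integrableP; split.
    by apply/measurable_EFinP; apply: measurable_funB; [exact: mZn|exact: mZ].
  by rewrite ltey.
have idd : mu.-integrable (slab 0 t) (EFin \o (fun p => dens_n n p - limit_density p)).
  exact: (integrableB mslab (dens_integrable n) limit_density_integrable).
have ih := hyp_increment_integrable hF hB (el n) e0 (lexx 0) t0.
have id : P.-integrable setT (EFin \o (fun w => hyp e (Zn n t w) - hyp e (Z t w))).
  apply: (@le_integrable_R _ _ _ _ _ (fun w => `|Zn n t w - Z t w|)).
  - by apply: measurable_funB; apply: mhyp; [exact: mZn|exact: mZ].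
  - by move=> w; exact: hyp_lip.
  - exact: integrable_norm.
have EL : \int[P]_w (hyp e (Z t w) - hyp e (Z 0 w)) =
   \int[P]_w (hyp e (Zn n t w) - hyp e (Zn n 0 w)) - \int[P]_w (hyp e (Zn n t w) - hyp e (Z t w)).
  by rewrite -RintegralB//; apply: eq_Rintegral => w _; rewrite Z0; ring.
have ER : \int[mu]_(p in slab 0 t) limit_density p = \int[mu]_(p in slab 0 t) dens_n n p -
   \int[mu]_(p in slab 0 t) (dens_n n p - limit_density p).
  rewrite RintegralB//; last exact: limit_density_integrable.
  by rewrite opprB addrC subrK.
have EI : \int[P]_w (hyp e (Zn n t w) - hyp e (Zn n 0 w)) =
    2^-1 * \int[mu]_(p in slab 0 t) dens_n n p := elementary_ito hF hB (el n) e0 t0.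
have -> : \int[P]_w (hyp e (Z t w) - hyp e (Z 0 w)) - 2^-1 * \int[mu]_(p in slab 0 t)
  limit_density p =
  - (\int[P]_w (hyp e (Zn n t w) - hyp e (Z t w))) +
  2^-1 * \int[mu]_(p in slab 0 t) (dens_n n p - limit_density p).
  by rewrite EL ER EI; ring.
apply: (@le_trans _ _ (`|\int[P]_w (hyp e (Zn n t w) - hyp e (Z t w))| +
  2^-1 * `|\int[mu]_(p in slab 0 t) (dens_n n p - limit_density p)|)%:E).
  rewrite lee_fin (le_trans (ler_normD _ _))// normrN lerD2l normrM.
  by rewrite (ger0_norm (_ : 0 <= 2^-1)).
rewrite EFinD EFinM; apply: leeD.
  rewrite EFin_normr_Rintegral//; apply: (le_trans (le_abse_integral _ _ _)) => //.
    by case/integrableP : id.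
  apply: ge0_le_integral => //.
  - exact: (measurable_int P (integrable_abse id)).
  - exact: (measurable_int P (integrable_norm i1)).
  - by move=> w _; rewrite /= lee_fin; exact: hyp_lip.
apply: lee_wpmul2l; first by rewrite lee_fin.
rewrite EFin_normr_Rintegral//; apply: le_abse_integral => //.
by case/integrableP : idd.
Qed.

End data.

Lemma ito_limit_formula Z H1 H2 e t : ito_limit P F B Z H1 H2 -> 0 < e -> 0 < t ->
  [/\ P.-integrable setT (EFin \o (fun w => Z t w - Z 0 w)),
      measurable_fun setT (limit_density Z H1 H2 e),
      mu.-integrable (slab 0 t) (EFin \o limit_density Z H1 H2 e) &
      \int[P]_w (hyp e (Z t w) - hyp e (Z 0 w)) =
      2^-1 * \int[mu]_(p in slab 0 t) limit_density Z H1 H2 e p].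
Proof.
move=> [m j j1 j2 [K K0 bd] [Zn [h1n [h2n [el z0 L1 l1 l2]]]]] e0 t0; split.
- exact: (limit_increment_integrable m el z0 L1 t0).
- exact: (measurable_limit_density j j1 j2 e0).
- exact: (limit_density_integrable j j1 j2 K0 bd e0 t0).
- exact: (limit_ito m j j1 j2 K0 bd el z0 L1 l1 l2 e0 t0).
Qed.

End limit_formula.

(** * Solutions as limits of elementary processes *)

Section sign.
Variable R : realType.

Lemma signE (x : R) : sign x = 2 * (\1_`]0, +oo[ x) - 1.
Proof.
rewrite /sign indicE leNgt.
have -> : (x \in `]0, +oo[%classic) = (0 < x).
  by apply/idP/idP => [/set_mem|h]; [|apply/mem_set]; rewrite /= in_itv/= andbT.
by case: (0 < x) => /=; lra.
Qed.

Lemma measurable_sign : measurable_fun setT (@sign R).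
Proof.
rewrite (_ : @sign R = fun x => 2 * (\1_`]0, +oo[ x) - 1); last by apply/funext => x;
  rewrite signE.
apply: measurable_funB => //; apply: measurable_funM => //.
Qed.

Lemma norm_sign (x : R) : `|sign x| = 1.
Proof.
by rewrite /sign leNgt; case: (0 < x) => /=; rewrite ?subr0 ?sub0r ?normrN normr1.
Qed.

(** [sign] takes the values 1 and -1 only, so its square difference detects a
    difference of signs. *)
Lemma sign_sqr (x y : R) : (sign x - sign y) ^+ 2 =
  4 * ((0 < x) (+) (0 < y))%:R.
Proof. by rewrite /sign !leNgt; case: (0 < x); case: (0 < y) => /=; lra. Qed.

End sign.

Section solution.
Context (R : realType) (d : measure_display) (Omega : measurableType d)
  (P : probability Omega R) (F : R -> set (set Omega)) (B : R -> Omega -> R * R)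
  (lambda : R).
Hypotheses (hF : is_filtration F) (hB : brownian_motion2 P F B).
Local Notation OR := (Omega * measurableTypeR R)%type.
Local Notation leb := (@lebesgue_measure R).
Local Notation mu := (P \x leb)%E.

Lemma step_integral0 (W : R -> Omega -> R) S w : simple_process F S -> step_integral W S 0 w = 0.
Proof.
move=> [h _]; rewrite /step_integral big1// => i _.
have /andP[t0 t1] := h i.
by rewrite !min_l// ?(le_trans t0 t1)// subrr mulr0.
Qed.

(** Matches the iterated integral over closed time intervals with the integral
    over a slab. *)
Lemma ito_integral_L2_limit (H : R -> Omega -> R) (S : nat -> step_process R Omega) :
  (forall n, simple_process F (S n)) -> jointly_measurable H ->
  (forall t, 0 <= t -> (fun n => \int[P]_w \int[lebesgue_measure]_(s in `[0%R, t])
                    ((step_value (S n) s w - H s w) ^+ 2)%:E)%E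
          @ \oo --> 0%E) -> L2_limit P (fun n => step_value (S n)) H.
Proof.
move=> hS jH cv t t0; have := cv t t0.
apply: cvg_trans; apply: near_eq_cvg; apply: nearW => n.
have mf : measurable_fun setT (fun p : OR => (step_value (S n) p.2 p.1 - H (Num.max 0 p.2) p.1)
  ^+ 2).
  apply: measurable_funX; apply: measurable_funB; last exact: jH.
  exact: (measurable_step_value hF (hS n)).
rewrite slab_tonelli1//; last by move=> p; exact: sqr_ge0.
apply: eq_integral => w _ /=.
rewrite integral_itv_obnd_cbnd.
  apply: eq_integral => u; rewrite inE/= in_itv/= => /andP[u0 _].
  by rewrite (max_r u0).
apply: measurable_funTS; apply/measurable_EFinP.
exact: (measurable_fun_pair2 w mf).
Qed.

(** The approximations are X_0 plus the two step integrals. They are adapted even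
    though the limiting integrals themselves need not be. *)
Lemma solution_ito_limit X : perturbed_tanaka_solution P F B lambda X ->
  ito_limit P F B X (fun t w => sign (X t w)) (fun _ _ => lambda).
Proof.
move=> [aX [cX [I1 [I2 [[_ [_ [mI1 [S1 [s1 [v1 i1]]]]]] [[_ [_ [mI2 [S2 [s2 [v2 i2]]]]]] XE]]]]]].
have mX t : 0 <= t -> measurable_fun setT (X t).
  by move=> t0; apply: (past_measurable hF t0); exact: aX.
have jX : jointly_measurable X by exact: jointly_measurable_continuous.
have js : jointly_measurable (fun t w => sign (X t w)).
  by apply: measurableT_comp; [exact: measurable_sign|exact: jX].
have jl : jointly_measurable (fun _ (_ : Omega) => lambda) by exact: measurable_cst.
split => //.
- exists (1 + `|lambda|); first by rewrite addr_ge0.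
  by move=> u w _; rewrite norm_sign lerDl lerDr.
- pose B1 t w := (B t w).1; pose B2 t w := (B t w).2.
  exists (fun n t w => X 0 w + (step_integral B1 (S1 n) t w + step_integral B2 (S2 n) t w)),
    (fun n => step_value (S1 n)), (fun n => step_value (S2 n)); split.
  + move=> n.
    have p0 : past F 0 (X 0) by exact: aX.
    have := elementaryD hF (elementary_cst B hF p0)
      (elementaryD hF (elementary_step1 hF hB (s1 n)) (elementary_step2 hF hB (s2 n))).
    congr elementary; apply/funext => t; apply/funext => w; first by rewrite add0r addr0.
    by rewrite !add0r.
  + by move=> n w; rewrite !step_integral0// !addr0.
  + move=> t t0.
    have sq0 (f : Omega -> R) : (0 <= \int[P]_w (f w ^+ 2)%:E)%E.
      by apply: integral_ge0 => w _; rewrite lee_fin sqr_ge0.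
    apply: (cvge0_eps _ _ (cvge0D (i1 t t0) (i2 t t0))).
    * by move=> n; apply: integral_ge0 => w _; rewrite lee_fin.
    * by move=> n; rewrite adde_ge0.
    move=> eps eps0; exists eps^-1; first by rewrite invr_ge0 ltW.
    move=> n.
    pose a w := step_integral B1 (S1 n) t w - I1 t w.
    pose b w := step_integral B2 (S2 n) t w - I2 t w.
    have mst1 : measurable_fun setT (step_integral B1 (S1 n) t).
      by apply: (past_measurable hF t0); apply: past_step_integral => // u u0;
        exact: past_B1 hB _ u0.
    have mst2 : measurable_fun setT (step_integral B2 (S2 n) t).
      by apply: (past_measurable hF t0); apply: past_step_integral => // u u0;
        exact: past_B2 hB _ u0.
    have ma : measurable_fun setT a by apply: measurable_funB => //; exact: mI1.
    have mb : measurable_fun setT b by apply: measurable_funB => //; exact: mI2.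
    have -> : (\int[P]_w `|X 0 w + (step_integral B1 (S1 n) t w + step_integral B2 (S2 n) t w)
      - X t w|%:E
      = \int[P]_w `|a w + b w|%:E)%E.
      apply: ae_eq_integral => //.
      - apply/measurable_EFinP; apply: measurableT_comp => //.
        apply: measurable_funB; last exact: mX.
        by apply: measurable_funD; [exact: mX|exact: measurable_funD].
      - by apply/measurable_EFinP; apply: measurableT_comp => //; exact: measurable_funD.
      - apply: filterS XE => w /(_ t t0) -> _; congr (`|_|%:E).
        by rewrite /a /b; ring.
    have ea : measurable_fun setT (fun w => (a w ^+ 2)%:E).
      by apply/measurable_EFinP; exact: measurable_funX.
    have eb : measurable_fun setT (fun w => (b w ^+ 2)%:E).
      by apply/measurable_EFinP; exact: measurable_funX.
    have ieps0 : 0 <= eps^-1 by rewrite invr_ge0 ltW.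
    rewrite -[X in (_ <= X + _)%E](integral_cst1 P eps).
    rewrite -ge0_integralD//; try by move=> w _; rewrite lee_fin sqr_ge0.
    rewrite -ge0_integralZl//; first last.
    * by move=> w _; rewrite adde_ge0// lee_fin sqr_ge0.
    * exact: emeasurable_funD.
    rewrite -ge0_integralD//; first last.
    * by apply: measurable_funeM; exact: emeasurable_funD.
    * by move=> w _; rewrite mule_ge0// adde_ge0// lee_fin sqr_ge0.
    * by move=> w _; rewrite lee_fin ltW.
    apply: ge0_le_integral => //.
    * by apply/measurable_EFinP; apply: measurableT_comp => //; exact: measurable_funD.
    * by apply: emeasurable_funD => //; apply: measurable_funeM; exact: emeasurable_funD.
    * move=> w _; rewrite [X in (_ <= X)%E](_ : _ =
        (eps + eps^-1 * (a w ^+ 2 + b w ^+ 2))%:E)// lee_fin.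
      apply: (le_trans (ler_normD _ _)).
      apply: (le_trans (lerD (norm_le_scaled (a w) eps0) (norm_le_scaled (b w) eps0))).
      have := ler_wpM2l ieps0 (sqr_ge0 (a w)); have := ler_wpM2l ieps0 (sqr_ge0 (b w)).
      by rewrite !mulr0; lra.
  + exact: (ito_integral_L2_limit s1 js v1).
  + exact: (ito_integral_L2_limit s2 jl v2).
Qed.

End solution.

(** * Pathwise uniqueness *)

Section uniqueness.
Context (R : realType) (d : measure_display) (Omega : measurableType d)
  (P : probability Omega R) (F : R -> set (set Omega)) (B : R -> Omega -> R * R)
  (lambda : R).
Hypotheses (hF : is_filtration F) (hB : brownian_motion2 P F B) (hlambda : lambda != 0).
Local Notation OR := (Omega * measurableTypeR R)%type.
Local Notation leb := (@lebesgue_measure R).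
Local Notation mu := (P \x leb)%E.

(** In the Ito formula for [hyp e Z] the density is at least
    [lambda ^+ 2 * hyp2 e Z], while the left-hand side is at most the mean
    displacement because [hyp e] is 1-Lipschitz. The bound does not depend on
    [e]. *)
Lemma nondegenerate_occupation Z H e t : ito_limit P F B Z H (fun _ _ => lambda) ->
  0 < e -> 0 < t ->
  mu.-integrable (slab 0 t) (EFin \o (fun p : OR => hyp2 e (Z (Num.max 0 p.2) p.1))) /\
  \int[mu]_(p in slab 0 t) hyp2 e (Z (Num.max 0 p.2) p.1) <=
    2 / lambda ^+ 2 * \int[P]_w `|Z t w - Z 0 w|.
Proof.
move=> il e0 t0.
have [iZ md idens E] := ito_limit_formula hF hB il e0 t0.
have l2 : 0 < lambda ^+ 2 by rewrite exprn_even_gt0.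
have mh : measurable_fun setT (fun p : OR => hyp2 e (Z (Num.max 0 p.2) p.1)).
  by apply: measurableT_comp; [exact: measurable_hyp2|exact: il_joint il].
have mslab := measurable_slab (Omega := Omega) (0 : R) t.
have ih : mu.-integrable (slab 0 t) (EFin \o (fun p : OR => hyp2 e (Z (Num.max 0 p.2) p.1))).
  apply: (slab_bounded_integrable P (ltW t0) mh (C := e^-1)) => p _.
  by rewrite ger0_norm ?hyp2_ge0 ?hyp2_le.
split => //.
have h1 : lambda ^+ 2 * \int[mu]_(p in slab 0 t) hyp2 e (Z (Num.max 0 p.2) p.1) <=
   \int[mu]_(p in slab 0 t) limit_density Z H (fun _ _ => lambda) e p.
  rewrite -RintegralZl//; apply: le_Rintegral => //.
    exact: (integrableZl mslab (lambda ^+ 2) ih).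
  by move=> p _; rewrite /limit_density mulrC ler_wpM2l ?hyp2_ge0// lerDr sqr_ge0.
have mZ u : 0 <= u -> measurable_fun setT (Z u) := il_meas il (t := u).
have h2 : \int[P]_w (hyp e (Z t w) - hyp e (Z 0 w)) <= \int[P]_w `|Z t w - Z 0 w|.
  apply: (le_trans (ler_norm _)); apply: Rintegral_le_norm.
  - by apply: measurable_funB; apply: measurableT_comp;
    [exact: measurable_hyp|exact/mZ/ltW|exact: measurable_hyp|exact: mZ].
  - by move=> w; exact: hyp_lip.
  - exact: integrable_norm.
rewrite E in h2.
rewrite mulrAC ler_pdivlMr// mulrC.
apply: (le_trans h1); lra.
Qed.

Section pair.
Variables X X' : R -> Omega -> R.
Hypotheses (sX : perturbed_tanaka_solution P F B lambda X)
  (sX' : perturbed_tanaka_solution P F B lambda X').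
Hypothesis X0 : {ae P, forall w, X 0 w = X' 0 w}.
Variable t : R.
Hypothesis t0 : 0 < t.

Let LX := solution_ito_limit hF hB sX.
Let LX' := solution_ito_limit hF hB sX'.
Let mslab : measurable (slab (Omega := Omega) 0 t). Proof. exact: measurable_slab. Qed.
Let mX u : 0 <= u -> measurable_fun setT (X u). Proof. exact: il_meas LX u. Qed.
Let mX' u : 0 <= u -> measurable_fun setT (X' u). Proof. exact: il_meas LX' u. Qed.
Let iX : P.-integrable setT (EFin \o (fun w => X t w - X 0 w)).
Proof. by have [] := ito_limit_formula hF hB LX (ltr01) t0. Qed.
Let iX' : P.-integrable setT (EFin \o (fun w => X' t w - X' 0 w)).
Proof. by have [] := ito_limit_formula hF hB LX' (ltr01) t0. Qed.
Let K := \int[P]_w `|X t w - X 0 w| + \int[P]_w `|X' t w - X' 0 w|.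
Let xp (p : OR) : R := X (Num.max 0 p.2) p.1.
Let xp' (p : OR) : R := X' (Num.max 0 p.2) p.1.

(** Convex combinations keep the coefficient [lambda] of the second Brownian
    component. *)
Let interpolation_occupation (th e : R) : 0 <= th <= 1 -> 0 < e ->
  mu.-integrable (slab 0 t) (EFin \o (fun p => hyp2 e (th * xp p + (1 - th) * xp' p))) /\
  \int[mu]_(p in slab 0 t) hyp2 e (th * xp p + (1 - th) * xp' p) <= 2 / lambda ^+ 2 * K.
Proof.
move=> /andP[th0 th1] e0.
have il : ito_limit P F B (fun t w => th * X t w + (1 - th) * X' t w)
    (fun t w => th * sign (X t w) + (1 - th) * sign (X' t w)) (fun _ _ => lambda).
  have := ito_limitD hF (ito_limitZ hF th LX) (ito_limitZ hF (1 - th) LX').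
  by congr ito_limit; apply/funext => u; apply/funext => w; ring.
have [ih h] := nondegenerate_occupation il e0 t0.
split => //; apply: (le_trans h).
rewrite ler_wpM2l ?divr_ge0 ?sqr_ge0// /K -RintegralD; try exact: integrable_norm; last by [].
have iN := integrable_norm iX; have iN' := integrable_norm iX'.
have [iZ _ _ _] := ito_limit_formula hF hB il ltr01 t0.
apply: le_Rintegral => //.
- exact: integrable_norm.
- exact: integrableD_R.
- move=> w _.
  rewrite (_ : _ - _ = th * (X t w - X 0 w) + (1 - th) * (X' t w - X' 0 w)); last by ring.
  apply: (le_trans (ler_normD _ _)); rewrite !normrM.
  rewrite (ger0_norm th0) (ger0_norm (_ : 0 <= 1 - th)) ?subr_ge0//.
  by apply: lerD; rewrite ler_piMl//; lra.
Qed.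

Let sign_change (p : OR) : R := (sign (xp p) - sign (xp' p)) ^+ 2.

Let LD := ito_limitD hF LX (ito_limitZ hF (-1) LX').

Let iD : P.-integrable setT (EFin \o (fun w => (X t w - X' t w) - (X 0 w - X' 0 w))).
Proof.
have [+ _ _ _] := ito_limit_formula hF hB LD ltr01 t0.
congr (integrable _ _ (EFin \o _)); apply/funext => w; ring.
Qed.

Let Delta := \int[P]_w `|(X t w - X' t w) - (X 0 w - X' 0 w)|.

(** The Ito formula for [hyp e] of the difference, in which the second Brownian
    component cancels. *)
Let difference_bound e : 0 < e ->
  mu.-integrable (slab 0 t) (EFin \o (fun p => hyp2 e (xp p - xp' p) * sign_change p)) /\
  Delta - e <= 2^-1 * \int[mu]_(p in slab 0 t) (hyp2 e (xp p - xp' p) * sign_change p).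
Proof.
move=> e0.
have [_ _ id E] := ito_limit_formula hF hB LD e0 t0.
have dE : limit_density (fun t w => X t w + -1 * X' t w)
   (fun t w => sign (X t w) + -1 * sign (X' t w)) (fun _ _ => lambda + -1 * lambda) e =
   (fun p => hyp2 e (xp p - xp' p) * sign_change p).
  apply/funext => p; rewrite /limit_density -/(xp p) -/(xp' p) /sign_change !mulN1r subrr.
  by rewrite expr0n/= addr0.
rewrite dE in id E; split; first exact: id.
rewrite -E.
have mh u : 0 <= u -> measurable_fun setT (fun w => hyp e (X u w + -1 * X' u w)).
  move=> u0; apply: (measurableT_comp (measurable_hyp e0)).
  by apply: measurable_funD; [exact: mX|apply: measurable_funM => //; exact: mX'].
have -> : \int[P]_w (hyp e (X t w + -1 * X' t w) - hyp e (X 0 w + -1 * X' 0 w)) =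
   \int[P]_w (hyp e ((X t w - X' t w) - (X 0 w - X' 0 w)) - e).
  congr fine; apply: ae_eq_integral => //.
  - by apply/measurable_EFinP; apply: measurable_funB; apply: mh => //; exact: ltW.
  - apply/measurable_EFinP; apply: measurable_funB => //.
    apply: (measurableT_comp (measurable_hyp e0)).
    by have /integrableP[/measurable_EFinP] := iD.
  - apply: filterS X0 => w -> _; congr (_%:E).
    by rewrite !mulN1r !subrr subr0 hyp0 ?ltW.
have ie : P.-integrable setT (EFin \o (fun _ : Omega => e)) by exact:
  finite_measure_integrable_cst.
have ih : P.-integrable setT (EFin \o (fun w => hyp e (X t w - X' t w - (X 0 w - X' 0 w)) - e)).
  apply: (@le_integrable_R _ _ _ _ _ (fun w => `|(X t w - X' t w) - (X 0 w - X' 0 w)|)).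
  - apply: measurable_funB => //.
    apply: (measurableT_comp (measurable_hyp e0)).
    by have /integrableP[/measurable_EFinP] := iD.
  - move=> w; have := hyp_lip 0 (X t w - X' t w - (X 0 w - X' 0 w)) e0.
    by rewrite (hyp0 (ltW e0)) subr0.
  - exact: integrable_norm.
have -> : Delta - e = \int[P]_w (`|(X t w - X' t w) - (X 0 w - X' 0 w)| - e).
  by rewrite RintegralB// ?Rintegral_cst1//; exact: integrable_norm.
apply: le_Rintegral => //.
- by apply: integrableB_R => //; exact: integrable_norm.
- by move=> w _; rewrite lerB// hyp_ge_norm.
Qed.

Let C0 := 2 + 16 / 3 * (2 * t + 2 / lambda ^+ 2 * K).

(** Sum of [difference_bound] over the scales 2^-k. Only the scale 2^-n survives
    the telescoping, so the interpolation bounds are needed at that scale alone. *)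
Let Delta_bound (n : nat) : n%:R * Delta <= C0.
Proof.
pose ek (k : nat) : R := 2^-1 ^+ k.
have ek0 k : 0 < ek k by rewrite exprn_gt0.
pose f k (p : OR) := hyp2 (ek k) (xp p - xp' p) * sign_change p.
have iF k : mu.-integrable (slab 0 t) (EFin \o f k) by have [] := difference_bound (ek0 k).
have [N N0 NC] : exists2 N, (0 < N)%N & 3 / ek n ^+ 2 <= N%:R.
  (* the mesh of the Riemann sum may depend on n: occupation bounds do not see it *)
  exists (Num.truncn (3 / ek n ^+ 2)).+1 => //.
  by have /andP[_ /ltW] := truncn_itv (divr_ge0 (ler0n R 3) (sqr_ge0 (ek n))).
have N0' : 0 < N%:R :> R by rewrite ltr0n.
pose g j (p : OR) := hyp2 (ek n) (j%:R / N%:R * xp p + (1 - j%:R / N%:R) * xp' p).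
have occ (j : 'I_N) : mu.-integrable (slab 0 t) (EFin \o g j) /\
    \int[mu]_(p in slab 0 t) g j p <= 2 / lambda ^+ 2 * K.
  apply: interpolation_occupation => //.
  by rewrite divr_ge0//= ler_pdivrMr// mul1r ler_nat ltnW.
have isum (I : Type) (r : seq I) (h : I -> OR -> R) :
    (forall i, mu.-integrable (slab 0 t) (EFin \o h i)) ->
    mu.-integrable (slab 0 t) (EFin \o (fun p => \sum_(i <- r) h i p)) /\
    \int[mu]_(p in slab 0 t) \sum_(i <- r) h i p = \sum_(i <- r) \int[mu]_(p in slab 0 t) h i p.
  move=> ih; elim: r => [|i r [IH1 IH2]].
    split; last by rewrite big_nil; under eq_Rintegral do rewrite big_nil;
      rewrite Rintegral_cst// mul0r.
    rewrite (_ : _ \o _ = cst 0%E); first exact: integrable0.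
    by apply/funext => p /=; rewrite big_nil.
  have -> : (fun p => \sum_(i <- i :: r) h i p) = (fun p => h i p + \sum_(i <- r) h i p).
    by apply/funext => p; rewrite big_cons.
  split; first exact: (integrableD mslab (ih i) IH1).
  by rewrite RintegralD// big_cons IH2.
have [iSf Sf] := isum _ (index_enum 'I_n) (fun k => f k) (fun k => iF k).
have [iSg Sg] := isum _ (index_enum 'I_N) (fun j => g j) (fun j => (occ j).1).
have icst : mu.-integrable (slab 0 t) (EFin \o (fun _ : OR => 2)).
  by apply: (slab_bounded_integrable P (ltW t0) (C := 2)) => // p _; rewrite ger0_norm.
have iNg : mu.-integrable (slab 0 t) (EFin \o (fun p : OR => N%:R^-1 * \sum_(j < N) g j p)).
  exact: (integrableZl mslab N%:R^-1 iSg).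
have pointwise (p : OR) : \sum_(k < n) f k p <= 32 / 3 * (2 + N%:R^-1 * \sum_(j < N) g j p).
  rewrite -mulr_suml /sign_change sign_sqr.
  have S := sum_hyp2 n (xp p - xp' p).
  have G0 : 0 <= N%:R^-1 * \sum_(j < N) g j p.
    by rewrite mulr_ge0 ?invr_ge0// sumr_ge0// => j _; exact: hyp2_ge0.
  case sc : ((0 < xp p) (+) (0 < xp' p)); last by rewrite /= mulr0 mulr0 mulr_ge0// addr_ge0.
  rewrite mulr1.
  have := sign_change_bound (ek0 n) N0 NC sc; rewrite -/(g _) => b.
  apply: (@le_trans _ _ (8 / 3 / hyp (ek n) (xp p - xp' p) * 4)).
    by rewrite ler_wpM2r.
  by move: b; rewrite -/(g _ p); set H := _^-1; set G := N%:R^-1 * _ => b; lra.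
have main : \int[mu]_(p in slab 0 t) \sum_(k < n) f k p <=
    32 / 3 * (2 * t + 2 / lambda ^+ 2 * K).
  apply: (@le_trans _ _ (\int[mu]_(p in slab 0 t) (32 / 3 * (2 + N%:R^-1 * \sum_(j < N) g j p)))).
    apply: le_Rintegral => //.
    exact: (integrableZl mslab (32 / 3) (integrableD mslab icst iNg)).
  rewrite RintegralZl//; last exact: (integrableD mslab icst iNg).
  rewrite ler_wpM2l// RintegralD// RintegralZl// Sg; apply: lerD.
    by rewrite /Rintegral (slab_integral_cst P 2 (ltW t0)) subr0.
  rewrite ler_pdivrMl//.
  apply: (@le_trans _ _ (\sum_(j < N) 2 / lambda ^+ 2 * K)).
    by apply: ler_sum => j _; have [] := occ j.
  by rewrite sumr_const card_ord -[leLHS]mulr_natl.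
have total : n%:R * Delta - \sum_(k < n) ek k <= 2^-1 * \int[mu]_(p in slab 0 t) \sum_(k < n) f
  k p.
  rewrite Sf mulr_sumr.
  have -> : n%:R * Delta - \sum_(k < n) ek k = \sum_(k < n) (Delta - ek k).
    by rewrite sumrB sumr_const card_ord mulr_natl.
  by apply: ler_sum => k _; have [] := difference_bound (ek0 k).
have := sum_half R n; rewrite -/(ek _) /C0; lra.
Qed.

Lemma solutions_agree_at : {ae P, forall w, X t w = X' t w}.
Proof.
have D0 : Delta = 0.
  apply/eqP; rewrite eq_le; apply/andP; split; last first.
    by apply: Rintegral_ge0.
  rewrite leNgt; apply/negP => Dpos.
  have /= := Delta_bound (Num.truncn (C0 / Delta)).+1.
  have C00 : 0 <= C0 by have := Delta_bound 0; rewrite mul0r.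
  have /andP[_] := truncn_itv (divr_ge0 C00 (ltW Dpos)).
  by rewrite ltr_pdivrMr// ltNge => /negP.
have mD : measurable_fun setT (fun w => ((X t w - X' t w) - (X 0 w - X' 0 w))%:E) :=
  measurable_int _ iD.
have I0 : (\int[P]_w `|((X t w - X' t w) - (X 0 w - X' 0 w))%:E| = 0)%E.
  have := EFin_Rintegral (integrable_norm iD).
  by rewrite -[X in _ = X%:E]/Delta D0.
have := (ae_eq_integral_abs P measurableT mD).1 I0.
apply: filterS2 X0 => w Xw /(_ I)/=[]; rewrite Xw subrr subr0 => /eqP.
by rewrite subr_eq0 => /eqP.
Qed.

End pair.
End uniqueness.

Theorem theorem1 (R : realType) (d : measure_display)
    (Omega : measurableType d) (P : probability Omega R)
    (F : R -> set (set Omega)) (B : R -> Omega -> R * R) (lambda : R)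
    (hF : is_filtration F) (hB : brownian_motion2 P F B)
    (hlambda : lambda != 0) :
  pathwise_unique P (perturbed_tanaka_solution P F B lambda).
Proof.
move=> X X' sX sX' X0.
have rational : {ae P, forall w, forall n k : nat, X (k%:R / n.+1%:R) w = X' (k%:R / n.+1%:R) w}.
  apply: ae_foralln => n; apply: ae_foralln => -[|k].
    by rewrite mul0r.
  by apply: (solutions_agree_at hF hB hlambda sX sX' X0); rewrite divr_gt0.
apply: filterS rational => w Xw t t0.
have [_ [cX _]] := sX; have [_ [cX' _]] := sX'.
have c := continuous_paths_grid (w := w) cX t0; have c' := continuous_paths_grid (w := w) cX' t0.
have E : (fun n => X (grid n t) w) = (fun n => X' (grid n t) w).
  by apply/funext => n; exact: Xw.
rewrite E in c.
exact: (cvg_unique _ c c').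
Qed.
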